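(* Let $C, C_1, C_{\rm x}>0$. There exist constants $\mathcal{C}_1,\mathcal{C}_1'>0$ depending only on $C, C_1, C_{\rm x}$ such that the following holds. Let $\tau\in(0,1)$, let $n,d$ be positive integers, let $\mathbf{P}$ be a distribution on $\mathbb{R}\times\mathbb{R}^d$, and let $(Y_i,X_i)_{i=1,\dots,n}$ be i.i.d. from $\mathbf{P}$. Assume that $\mathbb{E}\|X_1\|\le C_{\rm x}$ and that the loss is bounded: for every $\theta\in B_1(C_1)$, $\ell_\tau(Y,X^\top\theta)\in[0,C]$ almost surely for $(Y,X)\sim\mathbf{P}$. Let $\lambda=\sqrt{n}$ and $\varsigma=(C_{\rm x}n\sqrt{d})^{-1}$. Let $\theta^*\in\arg\min_{\theta\in\mathbb{R}^d}R(\theta)$, put $s^*=\|\theta^*\|_0$ and $R^*=R(\theta^* )$, and assume $1\le s^*<n<d$ and $\|\theta^*\|_1\le C_1-2d\varsigma$. Put $$\tilde\xi=\frac{s^*\log(n\sqrt{d}/s^* )}{\sqrt n}.$$ Then $$\mathbb{E}\,\mathbb{E}_{\theta\sim\hat\rho_\lambda}[R(\theta)]-R^*\le \mathcal{C}_1\,\tilde\xi,$$ and, for every $\varepsilon\in(0,1)$, with probability at least $1-\varepsilon$ (over the sample), $$\mathbb{E}_{\theta\sim\hat\rho_\lambda}[R(\theta)]-R^*\le \mathcal{C}_1'\left[\tilde\xi+n^{-1/2}\log(2/\varepsilon)\right].$$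
   Context: Quantile loss: $\ell_\tau(y,x)=(y-x)(\tau-\mathbf{1}_{\{y\le x\}})$ for $y,x\in\mathbb{R}$. Quantile risk: $R(\theta)=\mathbb{E}_{(Y,X)\sim\mathbf{P}}[\ell_\tau(Y,X^\top\theta)]$, $\theta\in\mathbb{R}^d$. Empirical risk: $r_n(\theta)=\frac1n\sum_{i=1}^n\ell_\tau(Y_i,X_i^\top\theta)$. $\|\cdot\|$ is the Euclidean norm, $\|\cdot\|_1$ the $\ell_1$-norm, $\|\theta\|_0$ the number of nonzero entries of $\theta$. $B_1(C_1)=\{\theta\in\mathbb{R}^d:\|\theta\|_1\le C_1\}$. The prior $\pi$ is the probability measure on $B_1(C_1)$ with Lebesgue density $\pi(\theta)\propto\prod_{i=1}^d(\varsigma^2+\theta_i^2)^{-2}$ on $B_1(C_1)$ (and zero outside), where $\varsigma>0$. For $\lambda>0$ the Gibbs posterior $\hat\rho_\lambda$ is the (data-dependent) probability measure $\hat\rho_\lambda({\rm d}\theta)=\frac{\exp[-\lambda r_n(\theta)]}{\int\exp[-\lambda r_n]\,{\rm d}\pi}\,\pi({\rm d}\theta)$. The outer expectation $\mathbb{E}$ is over the sample $(Y_i,X_i)_{i\le n}$. *)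

(* Defs.v *)
From HB Require Import structures.
From mathcomp Require Import all_boot all_order all_algebra.
From mathcomp Require Import all_classical all_reals all_analysis.
From mathcomp Require Import measurable_realfun.

Set Implicit Arguments.
Unset Strict Implicit.
Unset Printing Implicit Defensive.
Import Order.TTheory GRing.Theory Num.Theory.
Import numFieldNormedType.Exports.

Local Open Scope classical_set_scope.
Local Open Scope ring_scope.

(* R^d is the type d.-tuple R: the library equips it with the product
   sigma-algebra of the Borel sets of R (and 'rV[R]_d with none). *)

Section lebesgue_tuple.
Context {R : realType}.
Local Open Scope ereal_scope.

(* The library's Lebesgue measure lives on measurableTypeR R, which has the same
   carrier and the same measurable sets as R but another display. *)
Definition tuple_cons d (z : measurableTypeR R * d.-tuple R) : d.+1.-tuple R :=
  [tuple of z.1 :: z.2].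

Lemma measurable_tuple_cons d : measurable_fun setT (@tuple_cons d).
Proof.
apply: (@measurable_cons _ _ (measurableTypeR R * d.-tuple R)%type R fst d snd).
  exact: (@measurable_fst _ _ (measurableTypeR R) (d.-tuple R)).
exact: measurable_snd.
Qed.

Section cons_measure.
Variables (d : nat) (l : {sigma_finite_measure set (measurableTypeR R) -> \bar R})
  (m : {sigma_finite_measure set (d.-tuple R) -> \bar R}).

Definition cons_measure : set (d.+1.-tuple R) -> \bar R :=
  pushforward (l \x m) (@tuple_cons d).

Let cons_measure0 : cons_measure set0 = 0.
Proof. by rewrite /cons_measure /pushforward preimage_set0 measure0. Qed.

Let cons_measure_ge0 A : 0 <= cons_measure A.
Proof. exact: (measure_ge0 (l \x m)). Qed.

Let cons_measure_sigma_additive : semi_sigma_additive cons_measure.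
Proof.
have mcons := @measurable_tuple_cons d.
exact: (measure_semi_sigma_additive (s := pushforward _ _)).
Qed.

HB.instance Definition _ := isMeasure.Build _ _ _ cons_measure
  cons_measure0 cons_measure_ge0 cons_measure_sigma_additive.

Let sigma_finite_cons_measure : sigma_finite setT cons_measure.
Proof.
have /sigma_finiteP[F [FT ndF Foo]] := sigma_finiteT l.
have /sigma_finiteP[G [GT ndG Goo]] := sigma_finiteT m.
pose uncons (t : d.+1.-tuple R) : measurableTypeR R * d.-tuple R :=
  (thead t, [tuple of behead t]).
have unconsK : cancel (@tuple_cons d) uncons.
  by move=> [x t]; congr pair; apply: val_inj.
exists (fun k => uncons @^-1` (F k `*` G k)).
  apply/seteqP; split => [t _|//]; have [i _ Fi] : (\bigcup_i F i) (thead t) by rewrite -FT.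
  have [j _ Gj] : (\bigcup_j G j) [tuple of behead t] by rewrite -GT.
  exists (maxn i j) => //; split => /=.
  - by move: Fi; exact/subsetPset/ndF/leq_maxl.
  - by move: Gj; exact/subsetPset/ndG/leq_maxr.
move=> k; have [mF Fk] := Foo k; have [mG Gk] := Goo k; split.
  rewrite (_ : _ @^-1` _ =
    (@tnth _ R ^~ ord0 @^-1` F k) `&`
    ((fun t : d.+1.-tuple R => [tuple of behead t]) @^-1` G k))//.
  apply: measurableI; rewrite -[X in measurable X]setTI.
    exact: (@measurable_tnth _ R).
  exact: measurable_behead.
rewrite /cons_measure /pushforward (_ : _ @^-1` _ = F k `*` G k).
  by rewrite product_measure1E// lte_mul_pinfty// ge0_fin_numE.
by apply/seteqP; split => z; rewrite /preimage /mkset unconsK.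
Qed.

HB.instance Definition _ := Measure_isSigmaFinite.Build _ _ _ cons_measure
  sigma_finite_cons_measure.

End cons_measure.

Fixpoint lebesgue_tuple d : {sigma_finite_measure set (d.-tuple R) -> \bar R} :=
  match d with
  | 0 => \d_ [tuple]
  | d'.+1 => cons_measure lebesgue_measure (lebesgue_tuple d')
  end.

Lemma lebesgue_tuple_box d (A : 'I_d -> set R) : (forall i, measurable (A i)) ->
  lebesgue_tuple d [set t | forall i, A i (tnth t i)]
  = \prod_(i < d) lebesgue_measure (A i).
Proof.
elim: d A => [|d IHd] A mA /=.
  by rewrite big_ord0 diracE mem_set// => -[].
rewrite big_ord_recl -IHd => [|i]; last exact: mA.
rewrite /cons_measure /pushforward -product_measure1E; first last.
- rewrite (_ : [set _ | _] = \bigcap_(i in [set: 'I_d])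
    ((@tnth _ R ^~ i) @^-1` A (lift ord0 i))); last first.
    by apply/seteqP; split => t /= At i; [move=> _|]; exact: At.
  apply: fin_bigcap_measurable => // i _.
  by rewrite -[X in measurable X]setTI; apply: measurable_tnth.
- exact: mA.
congr (_ _); apply/seteqP; split => -[x t] /= => [At|[A0 At] i].
  by split => [|i]; [have := At ord0|have := At (lift ord0 i); rewrite tnthS].
by case: (unliftP ord0 i) => [j|] ->; rewrite ?tnthS.
Qed.

End lebesgue_tuple.

Section measure_with_density.
Context d (T : measurableType d) (R : realType).
Variables (mu : {measure set T -> \bar R}) (f : T -> R).
Hypotheses (f_ge0 : forall x, 0 <= f x) (mf : measurable_fun setT f).
Local Open Scope ereal_scope.

Definition with_density of (forall x, (0 <= f x)%R) & measurable_fun setT f :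
  set T -> \bar R := fun A => \int[mu]_(x in A) (f x)%:E.

Local Notation nu := (with_density f_ge0 mf).

Let nu0 : nu set0 = 0.
Proof. exact: integral_set0. Qed.

Let nu_ge0 A : 0 <= nu A.
Proof. by apply: integral_ge0 => x _; rewrite lee_fin. Qed.

Let nu_sigma_additive : semi_sigma_additive nu.
Proof.
move=> F mF tF mUF; rewrite /with_density; apply: cvg_toP.
  apply: ereal_nondecreasing_is_cvgn => m n mn.
  by apply: lee_sum_nneg_natr => // k _ _; exact: nu_ge0.
rewrite ge0_integral_bigcup//=.
- by apply/measurable_EFinP; apply: measurable_funS mf.
- by move=> x _; rewrite lee_fin.
Qed.

HB.instance Definition _ := isMeasure.Build _ _ _ nu
  nu0 nu_ge0 nu_sigma_additive.

End measure_with_density.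

Section quantile_regression.
Context {R : realType}.

Definition quantile_loss (tau y x : R) : R := (y - x) * (tau - (y <= x)%R%:R).

Section vectors.
Variable d : nat.
Implicit Types x theta : d.-tuple R.

Definition dotv x theta : R := \sum_(i < d) tnth x i * tnth theta i.
Definition norm2 x : R := Num.sqrt (\sum_(i < d) tnth x i ^+ 2).
Definition norm1 theta : R := \sum_(i < d) `|tnth theta i|.
Definition norm0 theta : nat := #|[pred i | tnth theta i != 0]|.

Definition l1_ball (C1 : R) : set (d.-tuple R) :=
  [set theta | norm1 theta <= C1].

End vectors.

(* Valued in \bar R: the loss is nonnegative (0 <= tau <= 1) but need not be
   P-integrable. *)
Definition quantile_risk d (P : probability (R * d.-tuple R)%type R) (tau : R)
    (theta : d.-tuple R) : \bar R :=
  (\int[P]_z (quantile_loss tau z.1 (dotv z.2 theta))%:E)%E.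

Definition empirical_risk d n (tau : R) (z : 'I_n -> R * d.-tuple R)
    (theta : d.-tuple R) : R :=
  n%:R^-1 * \sum_(i < n) quantile_loss tau (z i).1 (dotv (z i).2 theta).

Definition prior_weight d (varsigma C1 : R) (theta : d.-tuple R) : R :=
  (\prod_(i < d) ((varsigma ^+ 2 + tnth theta i ^+ 2) ^+ 2)^-1)
  * \1_(l1_ball C1) theta.

Definition gibbs_weight d n (lambda tau : R) (z : 'I_n -> R * d.-tuple R)
    (theta : d.-tuple R) : R :=
  expR (- (lambda * empirical_risk tau z theta)).

Lemma measurable_dotv d (x : d.-tuple R) : measurable_fun setT (dotv x).
Proof.
apply: measurable_sum => i; apply: measurable_funM => //.
exact: measurable_tnth.
Qed.

Lemma measurable_norm1 d : measurable_fun setT (@norm1 d).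
Proof.
apply: measurable_sum => i; apply: measurableT_comp => //.
exact: measurable_tnth.
Qed.

Lemma measurable_l1_ball d C1 : measurable (@l1_ball d C1).
Proof.
rewrite (_ : l1_ball C1 = setT `&` @norm1 d @^-1` `]-oo, C1]).
  exact: measurable_norm1.
by rewrite setTI; apply/seteqP; split => t /=; rewrite in_itv.
Qed.

Lemma measurable_quantile_loss (tau y : R) :
  measurable_fun setT (quantile_loss tau y).
Proof.
apply: measurable_funM; first exact: measurable_funB.
apply: measurable_funB => //.
rewrite (_ : (fun x => _) = \1_(`[y, +oo[%classic) :> (R -> R)); last first.
  apply/funext => x; rewrite indicE; congr (nat_of_bool _)%:R.
  by rewrite mem_setE in_itv/= andbT.
exact: measurable_indic.
Qed.

Lemma measurable_empirical_risk d n tau (z : 'I_n -> R * d.-tuple R) :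
  measurable_fun setT (empirical_risk tau z).
Proof.
apply: measurable_funM => //; apply: measurable_sum => i.
by apply: measurableT_comp; [exact: measurable_quantile_loss
                            |exact: measurable_dotv].
Qed.

Lemma prior_weight_ge0 d varsigma C1 (theta : d.-tuple R) :
  0 <= prior_weight varsigma C1 theta.
Proof.
by rewrite mulr_ge0// prodr_ge0// => i _; rewrite invr_ge0 sqr_ge0.
Qed.

Lemma measurable_prior_weight d varsigma C1 :
  measurable_fun setT (@prior_weight d varsigma C1).
Proof.
apply: measurable_funM; last by apply: measurable_indic; exact: measurable_l1_ball.
apply: measurable_prod => i _.
rewrite (_ : (fun t => _) = (fun t : d.-tuple R =>
    powR ((varsigma ^+ 2 + tnth t i ^+ 2) ^+ 2) (- 1))); last first.
  by apply/funext => t; rewrite powR_inv1// sqr_ge0.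
apply: (measurableT_comp (measurable_powR _)).
apply: measurable_funX; apply: measurable_funD => //.
by apply: measurable_funX; exact: measurable_tnth.
Qed.

Lemma gibbs_weight_ge0 d n lambda tau (z : 'I_n -> R * d.-tuple R) theta :
  0 <= gibbs_weight lambda tau z theta.
Proof. exact: expR_ge0. Qed.

Lemma measurable_gibbs_weight d n lambda tau (z : 'I_n -> R * d.-tuple R) :
  measurable_fun setT (gibbs_weight lambda tau z).
Proof.
apply: measurableT_comp => //; apply: measurableT_comp => //.
apply: measurable_funM => //; exact: measurable_empirical_risk.
Qed.

(* The second argument of mnormalize is returned only when the total mass is 0
   or +oo, which happens neither here for varsigma, C1 > 0, nor in
   gibbs_posterior for lambda, tau >= 0 and tau <= 1. *)
Definition prior d (varsigma C1 : R) : probability (d.-tuple R) R :=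
  mnormalize
    (with_density (lebesgue_tuple d) (@prior_weight_ge0 d varsigma C1)
       (@measurable_prior_weight d varsigma C1))
    (dirac ([tuple 0 | _ < d] : d.-tuple R)).

Definition gibbs_posterior d n (lambda tau : R) (pi : probability (d.-tuple R) R)
    (z : 'I_n -> R * d.-tuple R) : probability (d.-tuple R) R :=
  mnormalize
    (with_density pi (gibbs_weight_ge0 lambda tau z)
       (measurable_gibbs_weight lambda tau z))
    pi.

End quantile_regression.

Section iid.
Context d d' (Omega : measurableType d) (T : measurableType d') (R : realType).
Local Open Scope ereal_scope.

Definition mutually_independent n (Pr : probability Omega R)
    (Z : 'I_n -> {mfun Omega >-> T}) : Prop :=
  forall (J : {set 'I_n}) (A : 'I_n -> set T), (forall i, measurable (A i)) ->
    Pr [set w | forall i, i \in J -> A i (Z i w)]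
    = \prod_(i in J) Pr (Z i @^-1` A i).

Definition iid_from n (Pr : probability Omega R) (P : probability T R)
    (Z : 'I_n -> {mfun Omega >-> T}) : Prop :=
  mutually_independent Pr Z /\
  forall i A, measurable A -> distribution Pr (Z i) A = P A.

End iid.

(* Main.v *)
Require Import Defs.
From HB Require Import structures.
From mathcomp Require Import all_boot all_order all_algebra.
From mathcomp Require Import all_classical all_reals all_analysis.
From mathcomp Require Import measurable_realfun.
From mathcomp Require Import ring lra.


(* With [lambda = sqrt n], two deviations are controlled: [V], the prior integral
   over the l1 ball of [exp (lambda (R - r_n))], and [W], the average under the
   prior restricted to a small ball [S] around [theta_star] of
   [exp (lambda (r_n - Rbar))], where [Rbar = R_star + 2 / n] bounds the risk
   on [S]. Tangent inequalities for [exp] and [ln] (in place of the variational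
   formula for the Kullback-Leibler divergence) give, for every sample and every
   [p >= 1],
     lambda * E_rho[R] <= (V + W) / p + 2 ln p - 2 + lambda * Rbar - ln pi(S),
   and boundedness of the loss and independence bound the expectations of [V]
   and [W] by [exp (C ^ 2 exp C)]. Taking [p = exp (C ^ 2 exp C)] bounds the
   expected risk; Markov's inequality for [V + W] with
   [p = exp (C ^ 2 exp C) / eps] gives the tail.

   The prior mass of [S = {|theta - theta_star|_2 <= 2 varsigma sqrt d}] is
   estimated by translating the product Student density to [theta_star], which
   costs only the nonzero coordinates, and by Chebyshev's inequality, since the
   translated density has coordinate variance at most [varsigma ^ 2]. *)

Set Implicit Arguments.
Unset Strict Implicit.
Unset Printing Implicit Defensive.
Import Order.TTheory GRing.Theory Num.Theory.
Import numFieldNormedType.Exports.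

Local Open Scope classical_set_scope.
Local Open Scope ring_scope.

(** * Integration against densities and normalized measures *)

Section densities.
Context d (T : measurableType d) (R : realType).
Local Open Scope ereal_scope.
Import HBNNSimple.

(** [with_density] is given by its values on sets, which settles indicators; simple functions follow
    by linearity, and nonnegative measurable functions by monotone convergence on both sides. *)
Lemma integral_with_density (mu : {measure set T -> \bar R}) (f : T -> R)
    (f_ge0 : forall x, (0 <= f x)%R) (mf : measurable_fun setT f)
    (h : T -> \bar R) :
  measurable_fun setT h -> (forall x, 0 <= h x) ->
  \int[with_density mu f_ge0 mf]_x h x = \int[mu]_x (h x * (f x)%:E).
Proof.
move=> mh h0; pose g := nnsfun_approx measurableT mh.
set nu := with_density mu f_ge0 mf.
have cg x : EFin \o g ^~ x @ \oo --> h x by exact: cvg_nnsfun_approx.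
have ndg x : {homo g^~ x : a b / (a <= b)%N >-> (a <= b)%R}.
  by move=> a b ab; exact/lefP/nd_nnsfun_approx.
have -> : \int[nu]_x h x = limn (fun n => \int[nu]_x (g n x)%:E).
  rewrite -monotone_convergence//.
  - by apply: eq_integral => x _; apply/esym/cvg_lim => //; exact: cg.
  - by move=> n; exact/measurable_EFinP.
  - by move=> n x _; rewrite lee_fin.
  - by move=> x _ a b ab; rewrite lee_fin; exact: ndg.
have -> : \int[mu]_x (h x * (f x)%:E) =
    limn (fun n => \int[mu]_x ((g n x)%:E * (f x)%:E)).
  rewrite -monotone_convergence//.
  - apply: eq_integral => x _; apply/esym/cvg_lim => //.
    by apply: cvgeZr => //; exact: cg.
  - move=> n; apply: emeasurable_funM; exact/measurable_EFinP.
  - by move=> n x _; rewrite mule_ge0 ?lee_fin.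
  - by move=> x _ a b ab; rewrite lee_wpmul2r ?lee_fin//; exact: ndg.
congr (limn _); apply/funext => n.
rewrite integralT_nnsfun sintegralE.
transitivity (\int[mu]_x (\sum_(y \in range (g n))
    ((y * \1_(g n @^-1` [set y]) x)%:E * (f x)%:E))); last first.
  apply: eq_integral => x _; rewrite /= {1}(fimfunE (g n) x) -fsumEFin//.
  by rewrite ge0_mule_fsuml// => y; exact: nnfun_muleindic_ge0.
rewrite ge0_integral_fsum//; last 2 first.
- move=> y; apply: emeasurable_funM; last exact/measurable_EFinP.
  by apply/measurable_EFinP; exact: measurable_funM.
- move=> y x _; apply: mule_ge0; first exact: nnfun_muleindic_ge0.
  by rewrite lee_fin.
apply: eq_fsbigr => r; rewrite inE => -[t _ <-].
under eq_integral do rewrite EFinM -muleA.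
rewrite ge0_integralZl//.
- rewrite /nu/= /with_density integral_mkcond; congr (_ * _).
  by apply: eq_integral => x _; rewrite epatch_indic /= muleC.
- by apply: emeasurable_funM; exact/measurable_EFinP.
- by move=> x _; rewrite mule_ge0 ?lee_fin.
- by rewrite lee_fin.
Qed.

(** A finite positive total mass excludes the default branch of [mnormalize]. *)
Lemma mnormalizeE (mu : {measure set T -> \bar R}) (P : probability T R)
    (m : R) (A : set T) :
  mu setT = m%:E -> (0 < m)%R -> mnormalize mu P A = mu A * (m^-1)%:E.
Proof. by move=> mum m0; rewrite /mnormalize mum orbF eqe gt_eqF. Qed.

Lemma integral_mnormalize (mu : {measure set T -> \bar R})
    (P : probability T R) (m : R) (h : T -> \bar R) :
  mu setT = m%:E -> (0 < m)%R ->
  measurable_fun setT h -> (forall x, 0 <= h x) ->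
  \int[mnormalize mu P]_x h x = (m^-1)%:E * \int[mu]_x h x.
Proof.
move=> mum m0 mh h0.
have m1 : (0 <= m^-1)%R by rewrite invr_ge0 ltW.
rewrite -[(m^-1)%:E]/((NngNum m1)%:num%:E) -(@ge0_integral_mscale _ _ _ _ _ measurableT)//.
apply: eq_measure_integral => A mA _.
by rewrite [LHS](mnormalizeE P A mum m0)/= /mscale/= muleC.
Qed.

End densities.

(** * Tonelli's theorem for Lebesgue measure on tuples *)

Section lebesgue_product.
Context {R : realType}.
Local Open Scope ereal_scope.

(** By construction the measure on [d.+1]-tuples is the image of a product measure under
    [tuple_cons]; a change of variables and Tonelli's theorem peel off the first coordinate. *)
Lemma integral_lebesgue_tuple_cons d (F : d.+1.-tuple R -> \bar R) :
  measurable_fun setT F -> (forall t, 0 <= F t) ->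
  \int[lebesgue_tuple d.+1]_t F t =
  \int[lebesgue_measure]_x \int[lebesgue_tuple d]_t F [tuple of x :: t].
Proof.
move=> mF F0.
have mc := @measurable_tuple_cons R d.
rewrite [LHS](_ : _ = \int[pushforward (lebesgue_measure \x lebesgue_tuple d)
   (@tuple_cons R d)]_t F t)//.
rewrite ge0_integral_pushforward// fubini_tonelli1//.
  by apply: measurableT_comp mc.
by move=> x; exact: F0.
Qed.

Lemma integral_lebesgue_tuple_prod d (h : 'I_d -> R -> R) :
  (forall i, measurable_fun setT (h i)) -> (forall i x, (0 <= h i x)%R) ->
  \int[lebesgue_tuple d]_t (\prod_(i < d) h i (tnth t i))%:E =
  \prod_(i < d) \int[lebesgue_measure]_x (h i x)%:E.
Proof.
elim: d h => [|d IHd] h mh h0.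
  rewrite big_ord0 /= integral_dirac//=; last first.
    apply: eq_measurable_fun (@measurable_cst _ _ _ _ _ 1) => t _.
    by rewrite big_ord0.
  by rewrite diracT mul1e big_ord0.
have mp k (g : 'I_k -> R -> R) : (forall i, measurable_fun setT (g i)) ->
    measurable_fun setT (fun t : k.-tuple R => (\prod_(i < k) g i (tnth t i))%:E).
  move=> mg; apply/measurable_EFinP; apply: measurable_prod => i _.
  by apply: measurableT_comp => //; exact: measurable_tnth.
have p0 k (g : 'I_k -> R -> R) t : (forall i x, 0 <= g i x)%R ->
    0 <= (\prod_(i < k) g i (tnth t i))%:E.
  by move=> g0; rewrite lee_fin prodr_ge0.
rewrite integral_lebesgue_tuple_cons; [|exact: mp|by move=> t; exact: p0].
rewrite big_ord_recl -(IHd (fun i => h (lift ord0 i)))//.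
transitivity (\int[lebesgue_measure]_x ((h ord0 x)%:E *
    \int[lebesgue_tuple d]_t (\prod_(i < d) h (lift ord0 i) (tnth t i))%:E)).
  apply: eq_integral => x _.
  rewrite -ge0_integralZl//; first last.
  - exact: h0.
  - by move=> t _; exact: (p0 d (fun i => h (lift ord0 i))).
  - exact: (mp d (fun i => h (lift ord0 i))).
  apply: eq_integral => t _; rewrite big_ord_recl -EFinM; congr (_ * _)%:E.
  by apply: eq_bigr => i _; rewrite tnthS.
rewrite ge0_integralZr//.
- by move/measurable_EFinP : (mh ord0).
- by move=> x _; rewrite lee_fin.
- by apply: integral_ge0 => t _; exact: (p0 d (fun i => h (lift ord0 i))).
Qed.

End lebesgue_product.

(** * The prior *)

(* [lebesgue_measure] lives on [measurableTypeR R], whose display differs from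
   the one [R] gets by default. *)
Lemma measurable_EFin_lebesgue {R : realType} (f : R -> R) :
  measurable_fun setT f ->
  measurable_fun (setT : set (measurableTypeR R)) (fun t => (f t)%:E).
Proof. by move/measurable_EFinP. Qed.

(** * The one-dimensional Student density *)

Section student.
Context {R : realType}.
Variable s : R.
Hypothesis s_gt0 : 0 < s.
Local Notation mu := (@lebesgue_measure R).

(** Unnormalized Student density with three degrees of freedom, scaled to variance [s ^+ 2]; it is
    the one-coordinate factor of [prior_weight]. *)
Definition student (t : R) : R := ((s ^+ 2 + t ^+ 2) ^+ 2)^-1.

Let den_gt0 t : 0 < s ^+ 2 + t ^+ 2.
Proof. by rewrite ltr_wpDr ?sqr_ge0// exprn_gt0. Qed.

Lemma student_gt0 t : 0 < student t.
Proof. by rewrite invr_gt0 exprn_gt0. Qed.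

Lemma continuous_student : continuous student.
Proof.
move=> t; apply: cvgV; first by rewrite expf_neq0// gt_eqF.
have c : (s ^+ 2 + x ^+ 2) @[x --> t] --> s ^+ 2 + t ^+ 2.
  by apply: cvgD; [exact: cvg_cst|exact: exprn_continuous].
exact: (continuous_comp c (@exprn_continuous _ 2 _)).
Qed.

Lemma measurable_student : measurable_fun setT student.
Proof. exact: continuous_measurable_fun continuous_student. Qed.

Lemma integral_shift (f : R -> R) (a : R) : continuous f -> (forall t, 0 <= f t) ->
  (\int[mu]_t (f (t - a))%:E = \int[mu]_t (f t)%:E)%E.
Proof.
move=> cf f0.
have dF x : derivable (fun t : R => t - a) x 1 by [].
have F1 : derive1 (fun t : R => t - a) = cst 1.
  by apply/funext => x; rewrite derive1E derive_val ?oppr0 ?addr0.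
have := @increasing_ge0_integration_by_substitutionT _ (fun t => t - a) f.
rewrite F1 => ->.
- by apply: eq_integral => t _ /=; rewrite mulr1.
- by move=> x y xy; rewrite ltrD2r.
- exact: cst_continuous.
- exact: is_cvg_cst.
- exact: is_cvg_cst.
- exact: dF.
- exact: cvg_addrr_Ny.
- exact: cvg_addrr.
- exact: cf.
- exact: f0.
Qed.

(** Comparison with a multiple of the Cauchy density: one factor [(s ^+ 2 + t ^+ 2)^-1] is at most
    [(s ^+ 2)^-1], the other at most [Num.max 1 (s ^+ 2)^-1] times [(1 + t ^+ 2)^-1]. *)
Lemma integral_student_lty : (\int[mu]_t (student t)%:E < +oo)%E.
Proof.
pose K := (s ^+ 2)^-1 * Num.max 1 (s ^+ 2)^-1.
have K0 : 0 <= K by rewrite mulr_ge0 ?invr_ge0 ?sqr_ge0// le_max ler01.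
apply: (@le_lt_trans _ _ (\int[mu]_t (K%:E * (oneDsqr t)^-1%:E))%E).
  apply: ge0_le_integral => //=.
  - by move=> t _; rewrite lee_fin ltW// student_gt0.
  - exact: measurable_EFin_lebesgue measurable_student.
  - apply: emeasurable_funM => //; apply: measurable_EFin_lebesgue.
    by apply: continuous_measurable_fun; exact: continuous_oneDsqrV.
  - move=> t _; rewrite -EFinM lee_fin /student /K /oneDsqr expr2 invfM -mulrA.
    have := den_gt0 t; have s20 : 0 < s ^+ 2 by rewrite exprn_gt0.
    have t20 : 0 <= t ^+ 2 by exact: sqr_ge0.
    set u := s ^+ 2 in s20 *; set v := t ^+ 2 in t20 * => uv0.
    rewrite ler_pM ?invr_ge0 ?(ltW uv0)//.
      by rewrite lef_pV2 ?posrE// lerDl.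
    rewrite -[leLHS]mul1r ler_pdivrMr// mulrAC ler_pdivlMr ?ltr_wpDr// mul1r.
    have [h1|h1] := leP 1 u^-1; rewrite ?mul1r.
      have u1 : u <= 1 by rewrite -invf_ge1.
      rewrite ler_pdivlMl//; nra.
    have u1 : 1 < u by rewrite -invf_lt1.
    by rewrite lerD2r ltW.
rewrite ge0_integralZl//.
- rewrite ge0_symfun_integralT//=.
  + rewrite -set_itvcy integral0y_oneDsqr -!EFinM ltry//.
  + exact: continuous_oneDsqrV.
  + by move=> t /=; rewrite /oneDsqr sqrrN.
- apply: measurable_EFin_lebesgue; by apply: continuous_measurable_fun; exact: continuous_oneDsqrV.
Qed.

Lemma integral_student_gt0 : (0 < \int[mu]_t (student t)%:E)%E.
Proof.
have c0 : 0 < ((s ^+ 2 + 1) ^+ 2)^-1 by rewrite invr_gt0 exprn_gt0// ltr_wpDr// exprn_gt0.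
apply: (@lt_le_trans _ _ (\int[mu]_(t in `[0%R, 1%R]) (((s ^+ 2 + 1) ^+ 2)^-1)%:E)%E).
  by rewrite integral_cst//= lebesgue_measure_itv/= lte_fin ltr01 oppr0 adde0 mule1 lte_fin.
apply: (@le_trans _ _ (\int[mu]_(t in `[0%R, 1%R]) (student t)%:E)%E).
  apply: ge0_le_integral => //=.
  - by move=> t _; rewrite lee_fin ltW.
  - apply: measurable_funTS; exact: measurable_EFin_lebesgue measurable_student.
  - move=> t; rewrite in_itv/= => /andP[t0 t1].
    rewrite lee_fin lef_pV2 ?posrE ?exprn_gt0// ?ltr_wpDr ?exprn_gt0//.
    rewrite lerXn2r ?nnegrE ?lerD2l ?exprn_ile1// ltW//.
    by rewrite ltr_wpDr ?exprn_gt0.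
apply: ge0_subset_integral => //=.
- exact: measurable_EFin_lebesgue measurable_student.
- by move=> t _; rewrite lee_fin ltW// student_gt0.
Qed.

(* [t / (s ^+ 2 + t ^+ 2)] is a primitive of [(s ^+ 2 - t ^+ 2) * student t]
   and vanishes at infinity. *)
Lemma second_moment_student :
  (\int[mu]_t (t ^+ 2 * student t)%:E <= (s ^+ 2)%:E * \int[mu]_t (student t)%:E)%E.
Proof.
have s20 : 0 < s ^+ 2 by rewrite exprn_gt0.
have ms := measurable_student.
have mt : measurable_fun setT (fun t : R => (t ^+ 2 * student t)).
  by apply: measurable_funM => //; exact: measurable_funX.
pose F t := t / (s ^+ 2 + t ^+ 2).
have dF (x : R) : is_derive x (1 : R) F ((s ^+ 2 - x ^+ 2) * student x).
  have d0 : s ^+ 2 + x ^+ 2 != 0 by rewrite gt_eqF.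
  apply: is_derive_eq; rewrite /student.
  rewrite /GRing.scale /=; field.
  by rewrite d0.
have cd : continuous (fun x : R => (s ^+ 2 - x ^+ 2) * student x).
  move=> x; apply: cvgM; last exact: continuous_student.
  by apply: cvgB; [exact: cvg_cst|exact: exprn_continuous].
(* The primitive [F] is odd and nonnegative to the right of 0, so its increment over a symmetric
   interval is nonnegative. Hence [t ^+ 2 * student t] integrates there to at most the integral of
   [s ^+ 2 * student t]. *)
have bnd n : (\int[mu]_(t in `[(- n.+1%:R)%R, n.+1%:R]) (t ^+ 2 * student t)%:E <=
    (s ^+ 2)%:E * \int[mu]_t (student t)%:E)%E.
  have nn : - n.+1%:R < n.+1%:R :> R by rewrite (@lt_trans _ _ 0)// ?oppr_lt0 ltr0n.
  have cF (x : R) : {for x, continuous F}.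
    by apply/differentiable_continuous/derivable1_diffP.
  have /= ftc := @continuous_FTC2 _ (fun x : R => (s ^+ 2 - x ^+ 2) * student x) F _ _ nn.
  have cI (f : R -> R) : continuous f ->
      mu.-integrable `[(- n.+1%:R)%R, n.+1%:R] (EFin \o f).
    move=> cf; apply: continuous_compact_integrable; first exact: segment_compact.
    exact: continuous_subspaceT.
  have Ige0 : (0 <= \int[mu]_(t in `[(- n.+1%:R)%R, n.+1%:R])
      ((s ^+ 2 - t ^+ 2) * student t)%:E)%E.
    rewrite ftc.
    - rewrite -EFinB lee_fin /F sqrrN mulNr opprK addr_ge0// divr_ge0//; exact: ltW.
    - exact: continuous_subspaceT.
    - split.
      + by move=> x _; exact: ex_derive.
      + by apply: cvg_at_right_filter; exact: cF.
      + by apply: cvg_at_left_filter; exact: cF.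
    - by move=> x _; rewrite derive1E; exact: derive_val.
  apply: (@le_trans _ _ (\int[mu]_(t in `[(- n.+1%:R)%R, n.+1%:R])
      (s ^+ 2 * student t)%:E)%E).
    rewrite [leRHS](_ : _ = \int[mu]_(t in `[(- n.+1%:R)%R, n.+1%:R])
        (((s ^+ 2 - t ^+ 2) * student t)%:E + (t ^+ 2 * student t)%:E))%E.
      rewrite integralD//= ?leeDr//.
      - exact: cI cd.
      - apply: (cI (fun t : R => t ^+ 2 * student t)) => x.
        by apply: cvgM; [exact: exprn_continuous|exact: continuous_student].
    by apply: eq_integral => t _; rewrite -EFinD; congr _%:E; ring.
  under eq_integral do rewrite EFinM.
  rewrite ge0_integralZl//=.
  - apply: lee_wpmul2l; first by rewrite lee_fin ltW.
    apply: ge0_subset_integral => //=.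
    + exact: measurable_EFin_lebesgue measurable_student.
    + by move=> t _; rewrite lee_fin ltW// student_gt0.
  - apply: measurable_funTS; exact: measurable_EFin_lebesgue measurable_student.
  - by move=> t _; rewrite lee_fin ltW// student_gt0.
  - by rewrite lee_fin ltW.
(* These intervals exhaust the line, so the bound passes to the limit. *)
pose I n : set R := `[(- n.+1%:R)%R, n.+1%:R]%classic.
have IT : \bigcup_n I n = setT.
  apply/seteqP; split => // t _; exists (Num.truncn `|t|) => //.
  by rewrite /I /= in_itv/= -ler_norml ltW// truncnS_gt.
have ndI : nondecreasing_seq I.
  apply/nondecreasing_seqP => n; apply/subsetPset => t; rewrite /I /= !in_itv/=.
  move=> /andP[t1 t2]; apply/andP; split.
    by apply: le_trans t1; rewrite lerN2 ler_nat.
  by apply: (le_trans t2); rewrite ler_nat.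
have cI : (\int[mu]_(t in I n) (t ^+ 2 * student t)%:E @[n --> \oo] -->
    \int[mu]_(t in \bigcup_n I n) (t ^+ 2 * student t)%:E)%E.
  apply: ge0_nondecreasing_set_cvg_integral => //.
  - by move=> n; exact: measurable_itv.
  - by move=> n; apply: measurable_funTS; exact: measurable_EFin_lebesgue.
  - by move=> n t _; rewrite lee_fin mulr_ge0 ?sqr_ge0// ltW// student_gt0.
rewrite IT in cI; apply: cvge_le cI.
by apply: nearW => n; exact: bnd.
Qed.

End student.

(** * Prior mass of a small ball *)

Section prior_mass.
Context {R : realType}.
Variables (d : nat) (s : R).
Hypotheses (d_gt0 : (0 < d)%N) (s_gt0 : 0 < s).
Local Notation mu := (@lebesgue_measure R).
Local Notation vol := (lebesgue_tuple d).
Implicit Types a : d.-tuple R.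

Definition sqdist a (t : d.-tuple R) : R := \sum_(i < d) (tnth t i - tnth a i) ^+ 2.

Definition small_ball a : set (d.-tuple R) :=
  [set t : d.-tuple R | sqdist a t <= 4 * d%:R * s ^+ 2].

(** Lower bound for the factor lost when the product Student density is translated by [a]. A zero
    coordinate costs nothing, whence the restricted product. *)
Definition shift_ratio a : R :=
  \prod_(i < d | tnth a i != 0) (4 * (1 + tnth a i ^+ 2 / s ^+ 2) ^+ 2)^-1.

Definition student_prod a (t : d.-tuple R) : R := \prod_(i < d) student s (tnth t i - tnth a i).

Lemma measurable_sqdist a : measurable_fun setT (sqdist a).
Proof.
apply: measurable_sum => i; apply: measurable_funX; apply: measurable_funB => //.
exact: measurable_tnth.
Qed.

Lemma sqdist_ge0 a t : 0 <= sqdist a t.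
Proof. by apply: sumr_ge0 => i _; rewrite sqr_ge0. Qed.

Lemma measurable_small_ball a : measurable (small_ball a).
Proof.
rewrite (_ : small_ball a = setT `&` sqdist a @^-1` `]-oo, 4 * d%:R * s ^+ 2]).
  exact: measurable_sqdist.
by rewrite setTI; apply/seteqP; split => t /=; rewrite in_itv.
Qed.

Lemma measurable_student_shift (x : R) : measurable_fun setT (fun t : R => student s (t - x)).
Proof.
apply: measurableT_comp; first exact: measurable_student.
exact: measurable_funB.
Qed.

Lemma measurable_student_prod a : measurable_fun setT (student_prod a).
Proof.
apply: measurable_prod => i _.
apply: (measurableT_comp (measurable_student_shift (tnth a i))).
exact: measurable_tnth.
Qed.

Lemma student_prod_ge0 a t : 0 <= student_prod a t.
Proof. by apply: prodr_ge0 => i _; rewrite ltW// student_gt0. Qed.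

Let I : R := fine (\int[mu]_t (student s t)%:E)%E.

Let IE : (\int[mu]_t (student s t)%:E = I%:E)%E.
Proof.
rewrite /I fineK// ge0_fin_numE ?integral_student_lty//.
by apply: integral_ge0 => t _; rewrite lee_fin ltW// student_gt0.
Qed.

Let I_gt0 : 0 < I.
Proof. by rewrite -lte_fin -IE integral_student_gt0. Qed.

Let IsE (x : R) : (\int[mu]_t (student s (t - x))%:E = I%:E)%E.
Proof.
rewrite -IE (@integral_shift _ (student s))//; first exact: continuous_student.
by move=> t; rewrite ltW// student_gt0.
Qed.

Lemma integral_student_prod a : (\int[vol]_t (student_prod a t)%:E = (I ^+ d)%:E)%E.
Proof.
rewrite (integral_lebesgue_tuple_prod (h := fun i t => student s (t - tnth a i))).
- under eq_bigr do rewrite IsE.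
  by rewrite prodEFin prodr_const card_ord.
- by move=> i; exact: measurable_student_shift.
- by move=> i x; rewrite ltW// student_gt0.
Qed.

Lemma integral_sqdist a :
  (\int[vol]_t (sqdist a t * student_prod a t)%:E <= (d%:R * s ^+ 2 * I ^+ d)%:E)%E.
Proof.
(* [h j] puts the squared deviation in coordinate [j] only, so each term of [sqdist] still leads to
   the integral of a product; coordinate [j] contributes at most [s ^+ 2 * I], the others [I]
   each. *)
pose h (j i : 'I_d) (t : R) : R :=
  (if i == j then (t - tnth a i) ^+ 2 else 1) * student s (t - tnth a i).
have h0 j i x : 0 <= h j i x.
  by rewrite mulr_ge0 ?(ltW (student_gt0 s_gt0 _))//; case: ifP; rewrite ?sqr_ge0.
have mh j i : measurable_fun setT (h j i).
  apply: measurable_funM; last exact: measurable_student_shift.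
  by case: (i == j) => //; apply: measurable_funX; exact: measurable_funB.
have mhp j : measurable_fun setT (fun t : d.-tuple R => (\prod_(i < d) h j i (tnth t i))%:E).
  apply/measurable_EFinP; apply: measurable_prod => i _.
  by apply: measurableT_comp => //; exact: measurable_tnth.
have hj j t : \prod_(i < d) h j i (tnth t i) =
    (tnth t j - tnth a j) ^+ 2 * student_prod a t.
  rewrite /h big_split/=; congr (_ * _).
  by rewrite -big_mkcond/= big_pred1_eq.
have -> : (\int[vol]_t (sqdist a t * student_prod a t)%:E =
    \sum_(j < d) \int[vol]_t (\prod_(i < d) h j i (tnth t i))%:E)%E.
  rewrite -ge0_integral_sum//; last by move=> j t _; rewrite lee_fin prodr_ge0.
  apply: eq_integral => t _; rewrite /sqdist mulr_suml sumEFin.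
  by under eq_bigr do rewrite -hj.
have hle j : (\int[vol]_t (\prod_(i < d) h j i (tnth t i))%:E <=
    (s ^+ 2 * I ^+ d)%:E)%E.
  rewrite integral_lebesgue_tuple_prod// (bigD1 j)//=.
  have -> : (\prod_(i < d | i != j) \int[mu]_x (h j i x)%:E = (I ^+ d.-1)%:E)%E.
    rewrite (eq_bigr (fun=> I%:E)) => [|i /negPf ij].
      rewrite prodEFin prodr_const; congr (_ ^+ _)%:E.
      by rewrite -[in RHS](card_ord d) -(cardC1 j); apply: eq_card.
    by rewrite -(IsE (tnth a i)); apply: eq_integral => x _; rewrite /h ij mul1r.
  have -> : (s ^+ 2 * I ^+ d)%:E = ((s ^+ 2 * I)%:E * (I ^+ d.-1)%:E)%E.
    by rewrite -EFinM -{1}(prednK d_gt0) [I ^+ _.+1]exprS mulrA.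
  apply: lee_wpmul2r; first by rewrite lee_fin exprn_ge0// ltW.
  rewrite EFinM -IE; apply: le_trans (second_moment_student s_gt0).
  rewrite le_eqVlt; apply/orP; left; apply/eqP.
  rewrite -(@integral_shift _ (fun t => t ^+ 2 * student s t) (tnth a j)).
  - by apply: eq_integral => x _; rewrite /h eqxx.
  - move=> x; apply: cvgM; [exact: exprn_continuous|exact: continuous_student].
  - by move=> x; rewrite mulr_ge0 ?sqr_ge0// ltW// student_gt0.
apply: (le_trans (lee_sum _ (fun j _ => hle j))).
by rewrite sumEFin sumr_const card_ord lee_fin -[leLHS]mulr_natl -[leRHS]mulrA.
Qed.

(** Chebyshev's inequality: outside the ball [sqdist] exceeds four times the bound [d%:R * s ^+ 2]
    on its mean, so at most a quarter of the mass [I ^+ d] lies there. *)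
Lemma integral_small_ball a :
  ((3 / 4 * I ^+ d)%:E <= \int[vol]_(t in small_ball a) (student_prod a t)%:E)%E.
Proof.
have mS := measurable_small_ball a.
have mp : measurable_fun setT (fun t => (student_prod a t)%:E).
  by apply/measurable_EFinP; exact: measurable_student_prod.
have p0 t : (0 <= (student_prod a t)%:E)%E by rewrite lee_fin student_prod_ge0.
have ds0 : 0 < 4 * d%:R * s ^+ 2 by rewrite !mulr_gt0 ?ltr0n ?exprn_gt0.
have : (\int[vol]_(t in small_ball a) (student_prod a t)%:E +
    \int[vol]_(t in ~` small_ball a) (student_prod a t)%:E = (I ^+ d)%:E)%E.
  rewrite -ge0_integral_setU//; last 3 first.
  - exact: measurableC.
  - by rewrite setUv.
  - by apply/disj_setPCl.
  by rewrite setUv integral_student_prod.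
have : (\int[vol]_(t in ~` small_ball a) (student_prod a t)%:E <= (4^-1 * I ^+ d)%:E)%E.
  apply: (@le_trans _ _ (\int[vol]_(t in ~` small_ball a)
      ((4 * d%:R * s ^+ 2)^-1%:E * (sqdist a t * student_prod a t)%:E)))%E.
    apply: ge0_le_integral => //.
    - exact: measurableC.
    - exact: measurable_funTS.
    - apply: measurable_funTS; apply/measurable_EFinP; apply: measurable_funM => //.
      apply: measurable_funM; [exact: measurable_sqdist|exact: measurable_student_prod].
    - move=> t /= /negP; rewrite -ltNge => tS.
      rewrite -EFinM lee_fin mulrA ler_peMl ?student_prod_ge0//.
      by rewrite ler_pdivlMl// mulr1 ltW.
  rewrite ge0_integralZl//; first last.
  - by rewrite lee_fin invr_ge0 ltW.
  - by move=> t _; rewrite lee_fin mulr_ge0 ?sqdist_ge0 ?student_prod_ge0.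
  - apply: measurable_funTS; apply/measurable_EFinP.
    apply: measurable_funM; [exact: measurable_sqdist|exact: measurable_student_prod].
  - exact: measurableC.
  apply: (@le_trans _ _ ((4 * d%:R * s ^+ 2)^-1%:E * (d%:R * s ^+ 2 * I ^+ d)%:E)%E).
    apply: lee_wpmul2l; first by rewrite lee_fin invr_ge0 ltW.
    apply: le_trans (integral_sqdist a).
    apply: ge0_subset_integral => //.
    - exact: measurableC.
    - apply/measurable_EFinP.
      by apply: measurable_funM; [exact: measurable_sqdist|exact: measurable_student_prod].
    - by move=> t _; rewrite lee_fin mulr_ge0 ?sqdist_ge0 ?student_prod_ge0.
  rewrite -EFinM lee_fin le_eqVlt; apply/orP; left; apply/eqP; field.
  by rewrite !gt_eqF// ltr0n.
set x := (\int[vol]_(t in _) _)%E; set y := (\int[vol]_(t in _) _)%E => xle xy.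
have x0 : (0 <= x)%E by apply: integral_ge0.
have : x \is a fin_num by rewrite ge0_fin_numE// (le_lt_trans xle)// ltry.
move: xle xy => /[swap]; case: x x0 => [x||]// _ xy; rewrite lee_fin => xle _.
case: y xy => [y||]//= [xy]; rewrite lee_fin.
have := ltW (exprn_gt0 d I_gt0); move: (I ^+ d) xle xy => J; lra.
Qed.

(** Coordinatewise, after taking inverses and square roots, this is [s ^+ 2 + t ^+ 2 <= 2 * (1 + a
    ^+ 2 / s ^+ 2) * (s ^+ 2 + (t - a) ^+ 2)]. *)
Lemma student_prod_shift a t :
  shift_ratio a * student_prod a t <= \prod_(i < d) student s (tnth t i).
Proof.
have s20 : 0 < s ^+ 2 by rewrite exprn_gt0.
rewrite /shift_ratio big_mkcond -big_split/=; apply: ler_prod => i _.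
have c0 : 0 < 4 * (1 + tnth a i ^+ 2 / s ^+ 2) ^+ 2.
  by rewrite mulr_gt0// exprn_gt0// ltr_wpDr// divr_ge0 ?sqr_ge0// ltW.
apply/andP; split.
  by rewrite mulr_ge0 ?(ltW (student_gt0 s_gt0 _))//; case: ifP => _; rewrite ?invr_ge0 ?ltW.
case: ifPn => [_|/negPn/eqP ->]; last by rewrite subr0 mul1r.
rewrite /student -invfM lef_pV2 ?posrE; first last.
- by rewrite exprn_gt0// ltr_wpDr ?sqr_ge0.
- by rewrite mulr_gt0// exprn_gt0// ltr_wpDr ?sqr_ge0.
have -> : 4 * (1 + tnth a i ^+ 2 / s ^+ 2) ^+ 2 * (s ^+ 2 + (tnth t i - tnth a i) ^+ 2) ^+ 2
   = (2 * (1 + tnth a i ^+ 2 / s ^+ 2) * (s ^+ 2 + (tnth t i - tnth a i) ^+ 2)) ^+ 2.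
  by ring.
rewrite lerXn2r ?nnegrE//.
- by rewrite addr_ge0 ?sqr_ge0.
- by rewrite !mulr_ge0 ?addr_ge0 ?divr_ge0 ?sqr_ge0.
have -> : 2 * (1 + tnth a i ^+ 2 / s ^+ 2) * (s ^+ 2 + (tnth t i - tnth a i) ^+ 2) =
   2 * (s ^+ 2 + (tnth t i - tnth a i) ^+ 2) + 2 * tnth a i ^+ 2 +
   2 * ((tnth a i / s) * (tnth t i - tnth a i)) ^+ 2.
  by field; rewrite gt_eqF.
(* The right side exceeds the left by [s ^+ 2 + (u - 2 * v) ^+ 2 + 2 * z]. *)
have := sqr_ge0 (tnth a i / s * (tnth t i - tnth a i)).
set z := _ ^+ 2; have := sqr_ge0 (tnth t i - 2 * tnth a i).
move: (tnth t i) (tnth a i) => u v; nra.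
Qed.

Section prior_around.
Variables (C1 : R) (a : d.-tuple R).
Hypothesis a_le : norm1 a <= C1 - 2 * d%:R * s.

(* Coordinatewise AM-GM: [|x| <= x ^+ 2 / (4 * s) + s]. *)
Lemma small_ball_sub : small_ball a `<=` l1_ball C1.
Proof.
move=> t; rewrite /small_ball /l1_ball /= => tS.
suff : norm1 t <= norm1 a + 2 * d%:R * s by move=> /le_trans; apply; rewrite -lerBrDr.
have -> : norm1 a + 2 * d%:R * s = \sum_(i < d) (`|tnth a i| + 2 * s).
  by rewrite big_split/= sumr_const card_ord -mulr_natl; congr (_ + _); ring.
have h (i : 'I_d) : `|tnth t i| <= `|tnth a i| + ((tnth t i - tnth a i) ^+ 2 / (4 * s) + s).
  rewrite -{1}(subrK (tnth a i) (tnth t i)) addrC (le_trans (ler_normD _ _))// lerD2l.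
  move: (_ - _) => x; rewrite -[x ^+ 2]real_normK ?num_real//; set y := `|x|.
  have -> : y ^+ 2 / (4 * s) + s = y + (y - 2 * s) ^+ 2 / (4 * s).
    by field; rewrite gt_eqF.
  by rewrite lerDl divr_ge0 ?sqr_ge0// mulr_ge0// ltW.
apply: (le_trans (ler_sum _ (fun i _ => h i))).
rewrite 2!big_split/= [X in _ <= X]big_split/= lerD2l -mulr_suml.
rewrite !sumr_const !card_ord -[s *+ d]mulr_natl -[2 * s *+ d]mulr_natl.
have : \sum_(i < d) (tnth t i - tnth a i) ^+ 2 / (4 * s) <= d%:R * s.
  rewrite -mulr_suml ler_pdivrMr ?mulr_gt0// (le_trans tS)//.
  by rewrite le_eqVlt; apply/orP; left; apply/eqP; ring.
rewrite -mulr_suml; lra.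
Qed.

Let weighted : {measure set (d.-tuple R) -> \bar R} := with_density vol (@prior_weight_ge0 R d s C1)
  (@measurable_prior_weight R d s C1).

Let prior_weightE (t : d.-tuple R) :
  prior_weight s C1 t = (\prod_(i < d) student s (tnth t i)) * \1_(l1_ball C1) t.
Proof. by []. Qed.

(** Dropping the indicator of the l1 ball leaves the full product density, centered at the origin
    [o]. *)
Let weighted_leT : (weighted setT <= (I ^+ d)%:E)%E.
Proof.
pose o : d.-tuple R := [tuple 0 | _ < d].
have po t : student_prod o t = \prod_(i < d) student s (tnth t i).
  by apply: eq_bigr => i _; rewrite tnth_mktuple subr0.
rewrite -(integral_student_prod o); apply: ge0_le_integral => //.
- by move=> t _; rewrite lee_fin prior_weight_ge0.
- apply/measurable_EFinP; exact: measurable_prior_weight.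
- apply/measurable_EFinP; exact: measurable_student_prod.
- move=> t _; rewrite lee_fin prior_weightE -po ler_piMr ?student_prod_ge0//.
Qed.

(** The small ball lies inside the l1 ball, so the indicator equals 1 on it and the prior weight
    dominates [shift_ratio a] times the translated density. *)
Let weighted_ge : ((3 / 4 * shift_ratio a * I ^+ d)%:E <= weighted (small_ball a))%E.
Proof.
have k0 : 0 <= shift_ratio a.
  apply: prodr_ge0 => i _; rewrite invr_ge0 mulr_ge0// exprn_ge0// addr_ge0//.
  by rewrite divr_ge0// sqr_ge0.
rewrite mulrAC EFinM muleC.
apply: (@le_trans _ _ ((shift_ratio a)%:E *
    \int[vol]_(t in small_ball a) (student_prod a t)%:E)%E).
  by apply: lee_wpmul2l; rewrite ?lee_fin//; exact: integral_small_ball.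
have mS := measurable_small_ball a.
rewrite -ge0_integralZl//; last 2 first.
- by apply: measurable_funTS; apply/measurable_EFinP; exact: measurable_student_prod.
- by move=> t _; rewrite lee_fin student_prod_ge0.
apply: ge0_le_integral => //.
- by move=> t _; rewrite -EFinM lee_fin mulr_ge0// student_prod_ge0.
- apply: measurable_funTS; apply/measurable_EFinP; apply: measurable_funM => //.
  exact: measurable_student_prod.
- by apply: measurable_funTS; apply/measurable_EFinP; exact: measurable_prior_weight.
- move=> t tS; rewrite -EFinM lee_fin prior_weightE indicE mem_set.
    by rewrite mulr1 student_prod_shift.
  exact: small_ball_sub.
Qed.

Lemma shift_ratio_gt0 : 0 < shift_ratio a.
Proof.
apply: prodr_gt0 => i _; rewrite invr_gt0 mulr_gt0// exprn_gt0// ltr_wpDr//.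
by rewrite divr_ge0// sqr_ge0.
Qed.

(** The normalizer is positive and finite, so [prior] is the genuine normalized measure; its bound
    [I ^+ d] cancels against the same factor in [weighted_ge]. *)
Let weightedT : exists2 m : R, 0 < m <= I ^+ d & weighted setT = m%:E.
Proof.
have : ((3 / 4 * shift_ratio a * I ^+ d)%:E <= weighted setT)%E.
  apply: (le_trans weighted_ge); apply: le_measure; rewrite ?inE//.
  exact: measurable_small_ball.
have : 0 < 3 / 4 * shift_ratio a * I ^+ d.
  by rewrite !mulr_gt0 ?shift_ratio_gt0 ?exprn_gt0.
case: (weighted setT) weighted_leT => [m||] //=.
rewrite !lee_fin => mI c0 cm; exists m => //; apply/andP; split => //.
exact: lt_le_trans cm.
Qed.

Let priorE (m : R) A : 0 < m -> weighted setT = m%:E ->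
  prior d s C1 A = (weighted A * (m^-1)%:E)%E.
Proof.
by move=> m0 mE; exact: (mnormalizeE _ A mE).
Qed.

Lemma prior_small_ball : ((3 / 4 * shift_ratio a)%:E <= prior d s C1 (small_ball a))%E.
Proof.
have [m /andP[m0 mI] mE] := weightedT; rewrite (priorE _ m0 mE).
apply: (@le_trans _ _ ((3 / 4 * shift_ratio a * I ^+ d)%:E * (m^-1)%:E)%E).
  rewrite -EFinM lee_fin ler_pdivlMr// ler_wpM2l//.
  by rewrite mulr_ge0// ltW// shift_ratio_gt0.
by apply: lee_wpmul2r; rewrite ?lee_fin ?invr_ge0 ?(ltW m0)//; exact: weighted_ge.
Qed.

Lemma prior_l1_ballC : prior d s C1 (~` l1_ball C1) = 0%E.
Proof.
have [m /andP[m0 mI] mE] := weightedT; rewrite (priorE _ m0 mE).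
rewrite [weighted _](_ : _ = 0%E) ?mul0e//.
apply: integral0_eq => t tB; rewrite prior_weightE indicE memNset//.
by rewrite mulr0.
Qed.

End prior_around.

End prior_mass.

(** * Exponential moments *)

Section iid_product.
Context d d' (Omega : measurableType d) (T : measurableType d') (R : realType).
Variables (n : nat) (Pr : probability Omega R) (P : probability T R).
Variable Z : 'I_n -> {mfun Omega >-> T}.
Hypothesis iidZ : iid_from Pr P Z.
Local Open Scope ereal_scope.

(* Induction on the number [k] of coordinates carrying a general function; the
   remaining ones carry indicators. *)
Let iid_integral_prod_rec (k : nat) (g : 'I_n -> T -> R) :
  (forall i, measurable_fun setT (g i)) -> (forall i x, (0 <= g i x)%R) ->
  (forall i, \int[P]_x (g i x)%:E < +oo) ->
  (forall i : 'I_n, (k <= i)%N -> exists2 A, measurable A & g i = \1_A) ->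
  \int[Pr]_w (\prod_(i < n) g i (Z i w))%:E = \prod_(i < n) \int[P]_x (g i x)%:E.
Proof.
have [indZ lawZ] := iidZ.
elim: k g => [|k IHk] g mg g0 goo gA.
  (* With indicators only, the product is the indicator of an intersection, and the claim is mutual
     independence for the full index set. *)
  have {gA} /choice[A gA] : forall i, exists A, measurable A /\ g i = \1_A.
    by move=> i; have [A mA gi] := gA i (leq0n _); exists A.
  pose J : {set 'I_n} := [set: 'I_n]%SET.
  have mA i : measurable (A i) by have [] := gA i.
  rewrite (_ : (fun w => _) = EFin \o \1_[set w | forall i, i \in J -> A i (Z i w)]).
    have mB : measurable [set w | forall i, i \in J -> A i (Z i w)].
      rewrite (_ : [set _ | _] = \bigcap_(i in [set: 'I_n]) (Z i @^-1` A i)); last first.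
        by apply/seteqP; split => w /= h i; [move=> _; apply: h; rewrite inE|move=> _; exact: h].
      apply: fin_bigcap_measurable => // i _.
      by rewrite -[X in measurable X]setTI; exact: measurable_funP.
    rewrite integral_indic// setIT; apply: etrans (indZ J A mA) _.
    rewrite (eq_bigl xpredT) => [|i]; last by rewrite inE.
    apply: eq_bigr => i _; have [_ ->] := gA i.
    by rewrite integral_indic// setIT; exact: lawZ.
  apply/funext => w /=; congr _%:E; rewrite indicE.
  case: (pselect (forall i, A i (Z i w))) => [h|/existsNP[i h]].
    rewrite mem_set/=; last by move=> i _; exact: h.
    by apply: big1 => i _; have [_ ->] := gA i; rewrite indicE mem_set.
  rewrite memNset/=; last by move=> /(_ i); rewrite inE => /(_ isT).
  by rewrite (bigD1 i)//=; have [_ ->] := gA i; rewrite indicE memNset// mul0r.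
(* If [n <= k], no coordinate has index [k] or more, and the induction hypothesis applies
   directly. *)
have [nk|kn] := leqP n k.
  by apply: IHk => // i ki; have := ltn_ord i; rewrite ltnNge (leq_trans nk).
pose K := Ordinal kn.
pose G w := (\prod_(i < n | i != K) g i (Z i w))%R.
have G0 w : (0 <= G w)%R by exact: prodr_ge0.
have mgZ i : measurable_fun setT (fun w => g i (Z i w)) by exact: measurableT_comp.
have mG : measurable_fun setT G.
  rewrite /G; under eq_fun do rewrite big_mkcond.
  by apply: measurable_prod => i _; case: (i != K).
have [c cE] : exists c : R, \prod_(i < n | i != K) \int[P]_x (g i x)%:E = c%:E.
  exists (\prod_(i < n | i != K) fine (\int[P]_x (g i x)%:E))%R.
  rewrite -prodEFin; apply: eq_bigr => i _; rewrite fineK// ge0_fin_numE//.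
  by apply: integral_ge0 => x _; rewrite lee_fin.
have c0 : (0 <= c)%R.
  rewrite -lee_fin -cE; apply: prode_ge0 => i _.
  by apply: integral_ge0 => x _; rewrite lee_fin.
(* Under the measure of density [G], the product of the other factors, [Z K] is distributed as a
   multiple of [P]: on a set [B] this is the induction hypothesis with [g K] replaced by the
   indicator of [B]. *)
have lawE B : measurable B ->
    pushforward (with_density Pr G0 mG) (Z K) B = c%:E * P B.
  move=> mB; pose g' i := if i == K then \1_B else g i.
  have := IHk g'; rewrite (bigD1 K)//= /g' eqxx integral_indic// setIT.
  under eq_bigr => i /negPf -> do [].
  rewrite cE muleC => <-.
  - rewrite /pushforward /with_density integral_mkcond; apply: eq_integral => w _.
    rewrite epatch_indic/= (bigD1 K)//= eqxx mulrC EFinM; congr (_%:E * _).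
    by apply: eq_bigr => i /negPf ->.
  - by move=> i; case: ifP => // _; exact: measurable_indic.
  - by move=> i x; case: ifP => // _; rewrite indicE.
  - move=> i; case: ifP => // _; rewrite integral_indic// setIT.
    by rewrite (le_lt_trans (probability_le1 _ _))// ltry.
  - move=> i ki; case: ifPn => [_|iK]; first by exists B.
    by apply: gA; rewrite ltn_neqAle ki andbT; apply: contra iK => /eqP ki'; apply/eqP/val_inj.
have gK0 x : 0 <= (g K x)%:E by rewrite lee_fin.
have mgK : measurable_fun setT (fun x => (g K x)%:E) by exact/measurable_EFinP.
rewrite [RHS](bigD1 K)//= cE muleC.
rewrite -[c%:E]/((NngNum c0)%:num%:E) -(@ge0_integral_mscale _ _ _ _ _ measurableT)//.
(* Equality of the two measures on sets yields equality of the integrals of [g K]. *)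
transitivity (\int[pushforward (with_density Pr G0 mG) (Z K)]_x (g K x)%:E).
  rewrite ge0_integral_pushforward//= integral_with_density//=.
    apply: eq_integral => w _; rewrite (bigD1 K)//= EFinM//.
  exact: measurableT_comp.
by apply: eq_measure_integral => A mA _; exact: lawE.
Qed.

Lemma iid_integral_prod (g : 'I_n -> T -> R) :
  (forall i, measurable_fun setT (g i)) -> (forall i x, (0 <= g i x)%R) ->
  (forall i, \int[P]_x (g i x)%:E < +oo) ->
  \int[Pr]_w (\prod_(i < n) g i (Z i w))%:E = \prod_(i < n) \int[P]_x (g i x)%:E.
Proof.
move=> mg g0 goo; apply: (@iid_integral_prod_rec n) => // i.
by rewrite leqNgt ltn_ord.
Qed.

End iid_product.

(** * Exponential moments of centered bounded variables *)

Section exponential_moment.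
Context {R : realType}.

(** From [expR x - 1 <= x * expR x] one gets [expR x <= 1 + x + x * (expR x - 1)]. The last product
    is bounded by the same inequality when [0 < x], and by [x <= expR x - 1] otherwise. *)
Lemma expR_le_quadratic (x : R) : expR x <= 1 + x + x ^+ 2 * expR `|x|.
Proof.
have h1 : expR x - 1 <= x * expR x.
  have := expR_ge1Dx (- x); rewrite expRN.
  have e0 := expR_gt0 x; move: (expR x) e0 => y y0.
  by rewrite -(ler_pM2r y0) mulVf ?gt_eqF//; lra.
have h2 := expR_ge1Dx x.
have [x0|x0] := ler0P x; last first.
  suff : x * (expR x - 1) <= x ^+ 2 * expR x by lra.
  by rewrite expr2 -mulrA ler_wpM2l// ltW.
suff : x * (expR x - 1) <= x ^+ 2 * expR (- x) by lra.
have e1 : 1 <= expR (- x) by rewrite -expR0 ler_expR; lra.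
nra.
Qed.

(** In the quadratic bound for the exponential, the linear term has mean zero and the remainder is
    at most [D]; then [1 + D <= expR D]. *)
Lemma integral_expR_centered_le d (T : measurableType d) (P : probability T R)
    (f : T -> R) (m C s : R) :
  measurable_fun setT f -> (forall x, 0 <= f x) ->
  {ae P, forall x, f x <= C} -> (\int[P]_x (f x)%:E = m%:E)%E ->
  0 <= m <= C -> `|s| <= 1 ->
  (\int[P]_x (expR (s * (f x - m)))%:E <= (expR (s ^+ 2 * (C ^+ 2 * expR C)))%:E)%E.
Proof.
move=> mf f0 fC fm /andP[m0 mC] s1.
set D := s ^+ 2 * (C ^+ 2 * expR C).
have D0 : 0 <= D by rewrite mulr_ge0 ?sqr_ge0// mulr_ge0 ?sqr_ge0 ?expR_ge0.
have me : measurable_fun setT (fun x => expR (s * (f x - m))).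
  by apply: measurableT_comp => //; apply: measurable_funM => //; exact: measurable_funB.
have key x : f x <= C -> expR (s * (f x - m)) <= 1 + s * (f x - m) + D.
  move=> xC; apply: (le_trans (expR_le_quadratic _)); rewrite lerD2l.
  have fmC : `|f x - m| <= C by rewrite ler_norml; have := f0 x; lra.
  have C0 : 0 <= C by apply: le_trans m0 mC.
  rewrite exprMn -mulrA ler_wpM2l ?sqr_ge0// ler_pM ?sqr_ge0 ?expR_ge0//.
    by rewrite -[(f x - m) ^+ 2]real_normK ?num_real// lerXn2r ?nnegrE.
  by rewrite ler_expR normrM -[leRHS]mul1r ler_pM.
have cstP (c : R) : (\int[P]_x c%:E = c%:E)%E by rewrite integral_cst//= probability_setT mule1.
apply: (@le_trans _ _ (1 + D)%:E); last by rewrite lee_fin expR_ge1Dx.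
(* According to the sign of [s], the linear terms are placed on the sides where they are
   nonnegative, so that all integrals add without integrability conditions. *)
have [s0|s0] := leP 0 s.
- have : (\int[P]_x ((expR (s * (f x - m)))%:E + (s * m)%:E) <=
          \int[P]_x ((1 + D)%:E + s%:E * (f x)%:E))%E.
    apply: ae_ge0_le_integral => //.
    + by move=> x _; rewrite adde_ge0 ?lee_fin ?expR_ge0// mulr_ge0.
    + by apply: emeasurable_funD => //; exact/measurable_EFinP.
    + by move=> x _; rewrite adde_ge0 ?mule_ge0 ?lee_fin// addr_ge0.
    + by apply: emeasurable_funD => //; apply: emeasurable_funM => //; exact/measurable_EFinP.
    + apply: filterS fC => x /key + _; rewrite -EFinM -!EFinD lee_fin; lra.
  rewrite !ge0_integralD ?ge0_integralZl//; first last.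
  all: try by move=> *; rewrite ?mule_ge0 ?lee_fin ?expR_ge0 ?mulr_ge0 ?addr_ge0.
  all: try by (apply: emeasurable_funM => //; exact/measurable_EFinP).
  all: try by exact/measurable_EFinP.
  rewrite !cstP fm; case: (\int[P]_x _)%E => [y||]//=; last by rewrite !leNye.
  by rewrite -EFinM -!EFinD !lee_fin; lra.
- have Ns0 : 0 <= - s by rewrite oppr_ge0 ltW.
  have : (\int[P]_x ((expR (s * (f x - m)))%:E + (- s)%:E * (f x)%:E) <=
          \int[P]_x ((1 + D) + (- s) * m)%:E)%E.
    apply: ae_ge0_le_integral => //.
    + by move=> x _; rewrite -EFinM -EFinD lee_fin addr_ge0 ?expR_ge0 ?mulr_ge0.
    + by apply: emeasurable_funD; [|apply: emeasurable_funM => //]; exact/measurable_EFinP.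
    + by move=> x _; rewrite lee_fin addr_ge0 ?(mulr_ge0 Ns0)// addr_ge0.
    + apply: filterS fC => x /key + _; rewrite -EFinM -!EFinD lee_fin; lra.
  rewrite !ge0_integralD ?ge0_integralZl//; first last.
  all: try by move=> *; rewrite ?mule_ge0 ?lee_fin ?expR_ge0 ?Ns0.
  all: try by (apply: emeasurable_funM => //; exact/measurable_EFinP).
  all: try by exact/measurable_EFinP.
  rewrite !cstP fm; case: (\int[P]_x _)%E => [y||]//=; last by rewrite !leNye.
  by rewrite -EFinM -!EFinD !lee_fin; lra.
Qed.

(** Independence turns the one-variable bound into its [n]-th power, and [s ^+ 2 * n%:R <= 1] makes
    the result free of [n]; it also gives the condition on [s] of the one-variable bound. *)
Lemma iid_integral_expR_le d d' (Omega : measurableType d) (T : measurableType d')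
    (n : nat) (Pr : probability Omega R) (P : probability T R)
    (Z : 'I_n -> {mfun Omega >-> T}) (f : T -> R) (m C s : R) :
  iid_from Pr P Z ->
  measurable_fun setT f -> (forall x, 0 <= f x) ->
  {ae P, forall x, f x <= C} -> (\int[P]_x (f x)%:E = m%:E)%E ->
  0 <= m <= C -> (0 < n)%N -> s ^+ 2 * n%:R <= 1 ->
  (\int[Pr]_w (expR (s * \sum_(i < n) (f (Z i w) - m)))%:E
     <= (expR (C ^+ 2 * expR C))%:E)%E.
Proof.
move=> iidZ mf f0 fC fm mC n0 sn.
have s1 : `|s| <= 1.
  rewrite -[leRHS]normr1 -ler_sqr ?nnegrE// !real_normK ?num_real// expr1n.
  by apply: le_trans sn; rewrite ler_peMr ?sqr_ge0// ler1n.
have bnd := integral_expR_centered_le mf f0 fC fm mC s1.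
under eq_integral do rewrite mulr_sumr expR_sum.
rewrite (iid_integral_prod iidZ (g := fun _ x => expR (s * (f x - m)))); first last.
- by move=> i; apply: le_lt_trans bnd _; rewrite ltry.
- by move=> i x; exact: expR_ge0.
- move=> i; apply: measurableT_comp => //; apply: measurable_funM => //.
  exact: measurable_funB.
set E := (\int[P]_x _)%E in bnd *.
have : (0 <= E)%E by apply: integral_ge0 => x _; rewrite lee_fin expR_ge0.
case: E bnd => [y||]//; rewrite !lee_fin => bnd y0.
rewrite prodEFin prodr_const card_ord lee_fin.
apply: (@le_trans _ _ (expR (s ^+ 2 * (C ^+ 2 * expR C)) ^+ n)).
  by rewrite lerXn2r ?nnegrE ?expR_ge0.
rewrite -expRM_natl ler_expR mulrA -[leRHS]mul1r.
by rewrite ler_wpM2r 1?mulrC// mulr_ge0 ?sqr_ge0 ?expR_ge0.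
Qed.

End exponential_moment.

(** * Regularity of the quantile loss *)

Section quantile_loss.
Context {R : realType}.
Variable tau : R.
Hypothesis tau01 : 0 < tau < 1.

(** As a maximum of two linear functions with slopes of absolute value at most 1, the loss is
    visibly nonnegative, 1-Lipschitz and jointly measurable. *)
Lemma quantile_lossE (y x : R) :
  quantile_loss tau y x = Num.max (tau * (y - x)) ((tau - 1) * (y - x)).
Proof.
move/andP: tau01 => [t0 t1]; rewrite /quantile_loss.
case: leP => yx; rewrite ?subr0; rewrite mulrC.
  by apply/esym/max_idPr; nra.
by apply/esym/max_idPl; nra.
Qed.

Lemma quantile_loss_ge0 (y x : R) : 0 <= quantile_loss tau y x.
Proof.
move/andP: tau01 => [t0 t1]; rewrite quantile_lossE le_max.
by have [yx|yx] := leP 0 (y - x); apply/orP; [left|right]; nra.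
Qed.

Lemma quantile_loss_lipschitz (y x x' : R) :
  quantile_loss tau y x <= quantile_loss tau y x' + `|x - x'|.
Proof.
move/andP: tau01 => [t0 t1]; rewrite !quantile_lossE ge_max.
have := ler_norm (x - x'); have := ler_norm (- (x - x')); rewrite normrN => h1 h2.
apply/andP; split; rewrite -lerBlDr le_max; apply/orP; [left|right]; nra.
Qed.

Lemma measurable_quantile_loss_dotv d :
  measurable_fun setT (fun p : (R * d.-tuple R) * d.-tuple R =>
    quantile_loss tau p.1.1 (dotv p.1.2 p.2)).
Proof.
have m12 : measurable_fun setT (fun p : (R * d.-tuple R) * d.-tuple R => p.1.2).
  exact: (measurableT_comp measurable_snd measurable_fst).
have my : measurable_fun setT (fun p : (R * d.-tuple R) * d.-tuple R => p.1.1).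
  exact: (measurableT_comp measurable_fst measurable_fst).
have mdot : measurable_fun setT (fun p : (R * d.-tuple R) * d.-tuple R => dotv p.1.2 p.2).
  apply: measurable_sum => i; have mi := @measurable_tnth _ R d i.
  by apply: measurable_funM; [exact: (measurableT_comp mi m12)|
    exact: (measurableT_comp mi measurable_snd)].
under eq_fun do rewrite quantile_lossE.
by apply: measurable_maxr; apply: measurable_funM => //; exact: measurable_funB.
Qed.

(** Cauchy-Schwarz inequality, obtained by coordinatewise AM-GM with weights [A / N] and [N / A];
    the case of a zero vector [x] is separate because [N] is a denominator. *)
Lemma dotv_le d (x a b : d.-tuple R) (A : R) : 0 < A ->
  sqdist a b <= A ^+ 2 -> `|dotv x b - dotv x a| <= norm2 x * A.
Proof.
move=> A0 abA.
have -> : dotv x b - dotv x a = \sum_(i < d) tnth x i * (tnth b i - tnth a i).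
  by rewrite /dotv -sumrB; apply: eq_bigr => i _; rewrite mulrBr.
have nx0 : 0 <= norm2 x by exact: sqrtr_ge0.
have nxE : norm2 x ^+ 2 = \sum_(i < d) tnth x i ^+ 2.
  by rewrite sqr_sqrtr// sumr_ge0// => i _; rewrite sqr_ge0.
have [x0|xn0] := eqVneq (norm2 x) 0.
  rewrite big1 ?normr0 ?mulr_ge0// 1?ltW// => i _.
  suff -> : tnth x i = 0 by rewrite mul0r.
  apply/eqP; rewrite -sqrf_eq0; move/eqP: nxE; rewrite x0 expr0n eq_sym.
  by rewrite psumr_eq0 => [/allP/(_ i)/=|j _]; [apply; rewrite mem_index_enum|rewrite sqr_ge0].
have nxgt0 : 0 < norm2 x by rewrite lt_neqAle eq_sym xn0.
pose N := norm2 x; rewrite -/N in nx0 nxE nxgt0 *.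
apply: (@le_trans _ _ (\sum_(i < d)
   (A / N * tnth x i ^+ 2 + N / A * (tnth b i - tnth a i) ^+ 2) / 2)).
  apply: (le_trans (ler_norm_sum _ _ _)); apply: ler_sum => i _.
  rewrite normrM -[tnth x i ^+ 2]real_normK ?num_real//.
  rewrite -[(tnth b i - _) ^+ 2]real_normK ?num_real//.
  move: `|tnth x i| `|tnth b i - _| => u v.
  have -> : (A / N * u ^+ 2 + N / A * v ^+ 2) / 2 =
      u * v + (A * u - N * v) ^+ 2 / (2 * N * A).
    by field; rewrite !gt_eqF.
  by rewrite lerDl divr_ge0 ?sqr_ge0// !mulr_ge0// ltW.
rewrite -mulr_suml big_split/= -!mulr_sumr -nxE -/(sqdist a b).
have -> : A / N * N ^+ 2 = N * A by field; rewrite gt_eqF.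
have : N / A * sqdist a b <= N * A.
  have -> : N * A = N / A * A ^+ 2 by field; rewrite gt_eqF.
  by rewrite ler_wpM2l// divr_ge0// ltW.
lra.
Qed.

End quantile_loss.

(** * Oracle inequality for Gibbs posteriors *)

Local Ltac nonneg := solve [move=> *; rewrite -?EFinM -?EFinD ?lee_fin;
  repeat first [done | exact: expR_ge0 | exact: ltW | apply: mulr_ge0
    | apply: addr_ge0 | rewrite invr_ge0]].
Local Ltac meas := solve [apply: measurable_funTS;
  repeat first [done | apply: emeasurable_funD | apply: emeasurable_funM]].

Section gibbs.
Context d (T : measurableType d) (R : realType).
Variables (pi : probability T R) (lam : R) (r w : T -> R).
Hypotheses (lam_gt0 : 0 < lam) (r_ge0 : forall t, 0 <= r t).
Hypothesis mr : measurable_fun setT r.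
Hypothesis wE : forall t, w t = expR (- (lam * r t)).
Hypotheses (w_ge0 : forall t, 0 <= w t) (mw : measurable_fun setT w).
Local Open Scope ereal_scope.

Local Notation rho := (mnormalize (with_density pi w_ge0 mw) pi).

Let mwE : measurable_fun setT (fun t => (w t)%:E).
Proof. exact/measurable_EFinP. Qed.

(** The weight is positive everywhere, so a zero integral would make the whole space negligible for
    the probability [pi]. *)
Lemma gibbs_mass : exists2 z : R, (0 < z <= 1)%R & \int[pi]_t (w t)%:E = z%:E.
Proof.
have w0 t : (0 < w t)%R by rewrite wE expR_gt0.
have le1 : \int[pi]_t (w t)%:E <= 1.
  apply: (@le_trans _ _ (\int[pi]_t 1%:E)).
    apply: ge0_le_integral => //= [t _|t _]; rewrite lee_fin//.
    have -> : (1 = expR 0 :> R)%R by rewrite expR0.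
    by rewrite wE ler_expR oppr_le0 mulr_ge0// ltW.
  by rewrite integral_cst//= probability_setT mule1.
have ge0 : 0 <= \int[pi]_t (w t)%:E by apply: integral_ge0 => t _; rewrite lee_fin.
have neq0 : \int[pi]_t (w t)%:E != 0.
  apply/eqP => i0; have : \int[pi]_t `|(w t)%:E| = 0.
    by rewrite -i0; apply: eq_integral => t _; rewrite gee0_abs// lee_fin.
  move=> /(ae_eq_integral_abs pi measurableT mwE)[N [mN N0 sN]].
  have NT : N = setT.
    apply/seteqP; split => // t _; apply: sN => /=.
    by move=> /(_ I) /eqP; rewrite eqe gt_eqF.
  move: N0; rewrite NT => /(etrans (esym (probability_setT pi)))/eqP.
  by rewrite onee_eq0.
move: le1 ge0 neq0; case: (\int[pi]_t _) => [z||]//.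
rewrite !lee_fin eqe => z1 z0 zn0; exists z => //.
by rewrite z1 andbT lt_neqAle eq_sym zn0.
Qed.

Lemma integral_gibbs (h : T -> \bar R) (z : R) :
  measurable_fun setT h -> (forall t, 0 <= h t) ->
  \int[pi]_t (w t)%:E = z%:E ->
  \int[rho]_t h t = (z^-1)%:E * \int[pi]_t (h t * (w t)%:E).
Proof.
move=> mh h0 zE.
have z0 : (0 < z)%R by have [z' /andP[z'0 _]] := gibbs_mass; rewrite zE => -[->].
rewrite (@integral_mnormalize _ _ _ (with_density pi w_ge0 mw) pi z)//.
by rewrite integral_with_density.
Qed.

Variables (B S : set T) (risk : T -> \bar R) (riskR : T -> R) (Rbar sigma p : R).
Hypotheses (mB : measurable B) (mS : measurable S) (piBC : pi (~` B) = 0).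
Hypotheses (piS : pi S = sigma%:E) (sigma_gt0 : (0 < sigma)%R) (p_ge1 : (1 <= p)%R).
Hypotheses (mrisk : measurable_fun setT risk) (risk_ge0 : forall t, 0 <= risk t).
Hypotheses (mriskR : measurable_fun setT riskR) (riskR_ge0 : forall t, (0 <= riskR t)%R).
Hypothesis riskE : forall t, B t -> risk t = (riskR t)%:E.

(** [upper_dev] and [lower_dev] are the deviations [V] and [W]; dividing by [sigma], the mass of
    [S], makes the second an average. *)
Definition upper_dev : \bar R := \int[pi]_(t in B) (expR (lam * (riskR t - r t)))%:E.

Definition lower_dev : \bar R :=
  (sigma^-1)%:E * \int[pi]_(t in S) (expR (lam * (r t - Rbar)))%:E.

Let p_gt0 : (0 < p)%R. Proof. exact: lt_le_trans p_ge1. Qed.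

(* [expR] dominates its tangent at [b = ln p - ln z]. *)
Let gibbs_risk_le (z v : R) : \int[pi]_t (w t)%:E = z%:E -> upper_dev = v%:E ->
  lam%:E * \int[rho]_t risk t <= (p^-1 * v + ln p - ln z - 1)%:E.
Proof.
move=> zE vE.
have z01 : (0 < z <= 1)%R by have [z' z'1] := gibbs_mass; rewrite zE => -[->].
have /andP[z0 z1] := z01.
rewrite (integral_gibbs mrisk risk_ge0 zE).
have onB f : measurable_fun setT f -> (forall t, 0 <= f t) ->
    \int[pi]_t f t = \int[pi]_(t in B) f t.
  move=> mf f0; rewrite (@ge0_negligible_integral _ _ _ _ _ (~` B))//.
  - by rewrite setDE setTI setCK.
  - exact: measurableC.
rewrite onB; [|exact: emeasurable_funM|by move=> t; rewrite mule_ge0 ?lee_fin].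
under eq_integral => t /set_mem tB do rewrite riskE// -EFinM.
set b := (ln p - ln z)%R.
have b0 : (0 <= b)%R by rewrite subr_ge0 (le_trans (ln_le0 z1))// ln_ge0.
set X := \int[pi]_(t in B) _.
have mX : measurable_fun setT (fun t => (riskR t * w t)%:E).
  by apply/measurable_EFinP; exact: measurable_funM.
have X0 : 0 <= X by apply: integral_ge0 => t _; rewrite lee_fin mulr_ge0.
have mdev : measurable_fun setT (fun t => (expR (lam * (riskR t - r t)))%:E).
  apply/measurable_EFinP; apply: measurableT_comp => //; apply: measurable_funM => //.
  exact: measurable_funB.
(* The tangent inequality [lam * riskR t + 1 <= expR (- b) * expR (lam * riskR t) + b], multiplied
   by [w t] and integrated. All terms are nonnegative, since [z <= 1 <= p] gives [0 <= b]. *)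
have : lam%:E * X + z%:E <= (expR (- b))%:E * upper_dev + b%:E * z%:E.
  rewrite -zE onB//.
  rewrite /upper_dev -!ge0_integralZl//; first last.
  all: try nonneg; try meas.
  rewrite -!ge0_integralD//; first last.
  all: try nonneg; try meas.
  apply: ge0_le_integral; [exact: mB|nonneg|meas|meas|].
  move=> t _; rewrite -!EFinM -!EFinD lee_fin.
  have -> : (expR (lam * (riskR t - r t)) = expR (lam * riskR t) * w t)%R.
    by rewrite wE -expRD; congr expR; ring.
  have := expR_ge1Dx (lam * riskR t - b); rewrite expRD => h.
  rewrite mulrA -[X in (_ + X <= _)%R]mul1r mulrA -!mulrDl ler_wpM2r//.
  by rewrite [(expR (- b) * _)%R]mulrC; lra.
rewrite vE; case: X X0 => [x||]//=; last first.
  by move=> _; rewrite gt0_muley ?lte_fin// addye// -!EFinM -EFinD leye_eq.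
rewrite -!EFinM -!EFinD !lee_fin => x0 h.
have eb : (expR (- b) = z / p)%R.
  by rewrite opprB expRD expRN !lnK// posrE.
rewrite eb in h; rewrite -(ler_pM2r z0).
have -> : (lam * (z^-1 * x) * z = lam * x)%R by field; rewrite gt_eqF.
have -> : ((p^-1 * v + ln p - ln z - 1) * z = z / p * v + b * z - z)%R.
  by rewrite /b; ring.
by lra.
Qed.

(** A substitute for Jensen's inequality on [S]. With [y = lam * (r t - Rbar)], the tangents of
    [expR (a - y)] and of [expR (y - ln p)] add up to the constant [1 + p^-1 * v], by the choice of
    [a]. After integration the terms in [v] cancel, and logarithms conclude. *)
Let gibbs_mass_ge (z v : R) : \int[pi]_t (w t)%:E = z%:E -> lower_dev = v%:E ->
  (- ln z <= p^-1 * v + ln p - 1 + lam * Rbar - ln sigma)%R.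
Proof.
move=> zE vE.
have z01 : (0 < z <= 1)%R by have [z' z'1] := gibbs_mass; rewrite zE => -[->].
have /andP[z0 z1] := z01.
set a := (p^-1 * v + ln p - 1)%R.
have mdev : measurable_fun setT (fun t => (expR (lam * (r t - Rbar)))%:E).
  apply/measurable_EFinP; apply: measurableT_comp => //; apply: measurable_funM => //.
  exact: measurable_funB.
have devE : \int[pi]_(t in S) (expR (lam * (r t - Rbar)))%:E = (sigma * v)%:E.
  rewrite EFinM -vE /lower_dev muleA -EFinM divff ?mul1e// gt_eqF//.
have v0 : (0 <= v)%R.
  rewrite -(pmulr_rge0 _ sigma_gt0) -lee_fin -devE.
  by apply: integral_ge0 => t _; rewrite lee_fin expR_ge0.
have : (expR (- a) * (1 + p^-1 * v))%:E * pi S <=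
    (expR (lam * Rbar))%:E * \int[pi]_(t in S) (w t)%:E +
    (expR (- a) * p^-1)%:E * \int[pi]_(t in S) (expR (lam * (r t - Rbar)))%:E.
  rewrite -integral_cst// -!ge0_integralZl//; first last.
  all: try nonneg; try meas.
  rewrite -ge0_integralD//; first last.
  all: try nonneg; try meas.
  apply: ge0_le_integral; [exact: mS|nonneg| |meas|]; first exact: measurable_cst.
  move=> t _ /=; rewrite -!EFinM -!EFinD lee_fin.
  set y := (lam * (r t - Rbar))%R.
  have -> : (expR (lam * Rbar) * w t = expR (- a) * expR (a - y))%R.
    by rewrite wE -!expRD; congr expR; rewrite /y; ring.
  rewrite -mulrA -mulrDr ler_wpM2l ?expR_ge0//.
  have := expR_ge1Dx (a - y); have := expR_ge1Dx (y - ln p).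
  rewrite expRD expRN lnK ?posrE// [(expR y * _)%R]mulrC /a; lra.
rewrite devE piS.
have : \int[pi]_(t in S) (w t)%:E <= z%:E.
  by rewrite -zE; apply: ge0_subset_integral => // t _; rewrite lee_fin.
have : 0 <= \int[pi]_(t in S) (w t)%:E.
  by apply: integral_ge0 => t _; rewrite lee_fin.
case: (\int[pi]_(t in S) _) => [x||]//.
rewrite -!EFinM -!EFinD !lee_fin => x0 xz h.
have : (expR (- a) * sigma <= expR (lam * Rbar) * z)%R.
  have : (expR (lam * Rbar) * x <= expR (lam * Rbar) * z)%R by rewrite ler_wpM2l ?expR_ge0.
  have -> : (expR (- a) * sigma = expR (- a) * (1 + p^-1 * v) * sigma -
      expR (- a) * p^-1 * (sigma * v))%R by ring.
  by lra.
rewrite -ler_ln ?posrE ?mulr_gt0 ?expR_gt0// !lnM ?posrE ?expR_gt0// !expRK.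
by lra.
Qed.

(** The bound on the posterior risk still contains [- ln z], which [gibbs_mass_ge] controls. If a
    deviation is infinite, so is the right side. *)
Lemma gibbs_oracle :
  lam%:E * \int[rho]_t risk t <= (p^-1)%:E * (upper_dev + lower_dev) +
    (2 * ln p - 2 + lam * Rbar - ln sigma)%:E.
Proof.
have [z _ zE] := gibbs_mass.
have u0 : 0 <= upper_dev by apply: integral_ge0 => t _; rewrite lee_fin expR_ge0.
have l0 : 0 <= lower_dev.
  rewrite mule_ge0 ?lee_fin ?invr_ge0 ?(ltW sigma_gt0)//.
  by apply: integral_ge0 => t _; rewrite lee_fin expR_ge0.
have oo : (p^-1)%:E * +oo + (2 * ln p - 2 + lam * Rbar - ln sigma)%:E = +oo.
  by rewrite gt0_muley ?lte_fin ?invr_gt0// addye.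
move: u0 l0; case uE : upper_dev => [u||]// _; case lE : lower_dev => [l||]// _;
  rewrite ?addye ?addey// ?oo ?leey//.
apply: (le_trans (gibbs_risk_le zE uE)).
rewrite -[(_ * (_ + _))%E]/((p^-1 * (u + l))%:E) -EFinD lee_fin.
by have := gibbs_mass_ge zE lE; lra.
Qed.

End gibbs.

(** * Logarithmic cost of the translation *)

Section complexity.
Context {R : realType}.

Lemma ln_prod (I : Type) (r : seq I) (Q : pred I) (F : I -> R) :
  (forall i, Q i -> 0 < F i) ->
  ln (\prod_(i <- r | Q i) F i) = \sum_(i <- r | Q i) ln (F i).
Proof.
move=> F0; suff [] : 0 < \prod_(i <- r | Q i) F i /\
  ln (\prod_(i <- r | Q i) F i) = \sum_(i <- r | Q i) ln (F i) by [].
elim/big_rec2 : _ => [|i x y Qi [y0 <-]]; first by rewrite ln1.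
by rewrite mulr_gt0 ?F0// lnM ?posrE ?F0.
Qed.

Lemma ln_le_tangent (m x : R) : 0 < m -> 0 < x -> ln x <= ln m + x / m - 1.
Proof.
move=> m0 x0; have := expR_ge1Dx (ln x - ln m).
rewrite expRD expRN !lnK ?posrE//; lra.
Qed.

(* By concavity of [ln], the logarithmic cost of the nonzero coordinates of [a]
   is largest when they are all equal. *)
Lemma shift_ratio_cost d (a : d.-tuple R) (s : R) : 0 < s -> (0 < norm0 a)%N ->
  - ln (shift_ratio s a) <=
    (norm0 a)%:R * (2 * ln 2 + 4 * ln (1 + norm1 a / s / (norm0 a)%:R)).
Proof.
move=> s0 a0; rewrite /shift_ratio ln_prod; last first.
  move=> i _; rewrite invr_gt0 mulr_gt0// exprn_gt0// ltr_wpDr//.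
  by rewrite divr_ge0// sqr_ge0.
rewrite -sumrN; set k : R := (norm0 a)%:R; set m := 1 + _ / k.
have k0 : 0 < k by rewrite ltr0n.
have a1 : 0 <= norm1 a by apply: sumr_ge0.
have m0 : 0 < m by rewrite ltr_wpDr// !divr_ge0// ltW.
(* The tangent of [ln] is taken at [m], the mean of [1 + |a_i| / s] over the nonzero coordinates, so
   the linear terms cancel in the sum. *)
apply: (@le_trans _ _ (\sum_(i < d | tnth a i != 0)
    (2 * ln 2 + 4 * (ln m + (1 + `|tnth a i| / s) / m - 1)))).
  apply: ler_sum => i _.
  set x := `|tnth a i| / s.
  have x0 : 0 <= x by rewrite divr_ge0// ltW.
  have -> : tnth a i ^+ 2 / s ^+ 2 = x ^+ 2 by rewrite exprMn exprVn real_normK ?num_real.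
  have y0 : 0 < 1 + x ^+ 2 by rewrite ltr_wpDr ?sqr_ge0.
  have l2E (y : R) : 0 < y -> ln (y ^+ 2) = 2 * ln y.
    by move=> yp; rewrite lnXn// mulr2n; ring.
  rewrite lnV ?posrE ?mulr_gt0 ?exprn_gt0// opprK.
  have -> : 4 * (1 + x ^+ 2) ^+ 2 = (2 * (1 + x ^+ 2)) ^+ 2 by ring.
  rewrite l2E ?mulr_gt0// lnM ?posrE//.
  have h1 : ln (1 + x ^+ 2) <= 2 * ln (1 + x).
    rewrite -l2E ?ltr_wpDr// ler_ln ?posrE ?exprn_gt0 ?ltr_wpDr// ?sqr_ge0//.
    by rewrite sqrrD expr1n mul1r mulr2n; lra.
  have h2 := @ln_le_tangent m (1 + x) m0 (ltr_wpDr x0 ltr01).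
  lra.
set c := 2 * ln 2 + 4 * (ln m + 1 / m - 1).
rewrite (eq_bigr (fun i => c + 4 / (m * s) * `|tnth a i|)); last first.
  by move=> i _; rewrite /c; field; rewrite !gt_eqF.
rewrite big_split/= sumr_const -/(norm0 a) -mulr_sumr -[c *+ _]mulr_natl -/k.
apply: (@le_trans _ _ (k * c + 4 / (m * s) * norm1 a)).
  rewrite lerD2l ler_wpM2l//; first by rewrite divr_ge0// ltW// mulr_gt0.
  by rewrite /norm1 [leRHS](bigID (fun i => tnth a i != 0))/= lerDl sumr_ge0.
have mk : norm1 a = (m - 1) * k * s by rewrite /m; field; rewrite !gt_eqF.
by rewrite mk /c le_eqVlt; apply/orP; left; apply/eqP; field; rewrite !gt_eqF.
Qed.

(** The choice of [s] gives [b / s / k%:R = b * Cx * u], so the inner logarithm is at most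
    [ln (1 + C1 * Cx) + ln u]. Constants are absorbed by [1 <= 3 * ln u]: 10 is 4 plus 2 times 3,
    and 12 is 4 times 3. *)
Lemma complexity_le (C1 Cx : R) (n d k : nat) (b : R) :
  0 < C1 -> 0 < Cx -> (0 < k)%N -> (k < n)%N -> (n < d)%N -> 0 <= b <= C1 ->
  let u := n%:R * Num.sqrt d%:R / k%:R in
  let s := (Cx * n%:R * Num.sqrt d%:R)^-1 in
  1 <= 3 * (k%:R * ln u) /\
  k%:R * (2 * ln 2 + 4 * ln (1 + b / s / k%:R)) <=
    (10 + 12 * ln (1 + C1 * Cx)) * (k%:R * ln u).
Proof.
move=> C10 Cx0 k0 kn nd /andP[b0 bC1] u s.
have kR : (1 : R) <= k%:R by rewrite ler1n.
have kpos : (0 : R) < k%:R by rewrite ltr0n.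
have knR : (k%:R : R) <= n%:R by rewrite ler_nat ltnW.
have npos : (0 : R) < n%:R by apply: lt_le_trans knR.
(* The strict chain [0 < k < n < d] forces [3 <= d], which keeps [u] away from 1. *)
have d3 : (3 : R) <= d%:R by rewrite ler_nat (leq_trans _ nd)// ltnS (leq_trans _ kn).
have sd : 3 / 2 <= Num.sqrt d%:R :> R.
  rewrite -(@ler_pXn2r _ 2)// ?nnegrE ?sqrtr_ge0//.
  by rewrite sqr_sqrtr ?ler0n//; apply: le_trans d3; lra.
have u32 : 3 / 2 <= u.
  rewrite /u ler_pdivlMr//; nra.
have u0 : 0 < u by apply: lt_le_trans u32; lra.
have lnu : 1 / 3 <= ln u.
  have := @ln_le_tangent u 1 u0 ltr01; rewrite ln1 => h.
  have : 1 / u <= 2 / 3 by rewrite ler_pdivrMr//; lra.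
  lra.
split; first nra.
have c1 : 1 < 1 + C1 * Cx by rewrite ltrDl mulr_gt0.
have lnc : 0 <= ln (1 + C1 * Cx) by rewrite ln_ge0// ltW.
have ln2 : ln 2 <= 1 :> R.
  by have := @ln_le_tangent 1 2 ltr01 (ltr0Sn _ 1); rewrite ln1; lra.
have sE : b / s / k%:R = b * Cx * u.
  by rewrite /s /u invrK; field; rewrite gt_eqF.
have lnm : ln (1 + b / s / k%:R) <= ln (1 + C1 * Cx) + ln u.
  rewrite -lnM ?posrE//; last by apply: lt_trans c1.
  rewrite sE ler_ln ?posrE.
  - have : b * Cx * u <= C1 * Cx * u by rewrite ler_wpM2r ?ler_wpM2r// ltW.
    lra.
  - by rewrite ltr_wpDr// !mulr_ge0// ltW.
  - by rewrite mulr_gt0//; apply: lt_trans c1.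
have -> : (10 + 12 * ln (1 + C1 * Cx)) * (k%:R * ln u) =
  k%:R * ((10 + 12 * ln (1 + C1 * Cx)) * ln u) by ring.
rewrite ler_wpM2l ?ler0n//.
have : ln (1 + C1 * Cx) * (1 / 3) <= ln (1 + C1 * Cx) * ln u by rewrite ler_wpM2l.
lra.
Qed.

End complexity.

(** * Exchanging the sample and the parameter integrals *)

Section tonelli_bound.
Context d d' (Omega : measurableType d) (T : measurableType d') (R : realType).
Variables (Pr : probability Omega R) (pi : probability T R) (F : Omega * T -> R).
Variable D : set T.
Hypotheses (mF : measurable_fun setT F) (F0 : forall z, 0 <= F z) (mD : measurable D).
Local Open Scope ereal_scope.

(** The domain [D] is moved into the integrand so that Tonelli's theorem applies on the full product
    space. *)
Let G (z : Omega * T) : \bar R := (F z * \1_D z.2)%:E.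

Let mG : measurable_fun setT G.
Proof.
apply/measurable_EFinP; apply: measurable_funM => //.
by apply: measurableT_comp => //; exact: measurable_indic.
Qed.

Let G0 z : 0 <= G z. Proof. by rewrite lee_fin mulr_ge0. Qed.

Let integralG w : \int[pi]_(t in D) (F (w, t))%:E = \int[pi]_t G (w, t).
Proof.
rewrite integral_mkcond; apply: eq_integral => t _.
by rewrite epatch_indic/= /G EFinM.
Qed.

Lemma measurable_partial_integral :
  measurable_fun setT (fun w => \int[pi]_(t in D) (F (w, t))%:E).
Proof.
under eq_fun do rewrite integralG.
exact: (measurable_fun_fubini_tonelli_F (m2 := pi) G).
Qed.

Lemma integral_partial_le (c : R) : (0 <= c)%R ->
  (forall t, D t -> \int[Pr]_w (F (w, t))%:E <= c%:E) ->
  \int[Pr]_w \int[pi]_(t in D) (F (w, t))%:E <= c%:E * pi D.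
Proof.
move=> c0 Fc; under eq_integral do rewrite integralG.
rewrite (fubini_tonelli G)//.
apply: (@le_trans _ _ (\int[pi]_t (c%:E * (\1_D t)%:E))).
  apply: ge0_le_integral => //.
  - by move=> t _; apply: integral_ge0.
  - exact: (measurable_fun_fubini_tonelli_G (m1 := Pr) G).
  - by apply: emeasurable_funM => //; apply/measurable_EFinP; exact: measurable_indic.
  move=> t _; rewrite /G/= indicE; have [tD|tD] := boolP (t \in D).
    rewrite mule1; apply: le_trans (Fc t (set_mem tD)).
    by under eq_integral do rewrite mulr1.
  by under eq_integral do rewrite mulr0; rewrite integral0 mule0.
rewrite ge0_integralZl// ?integral_indic ?setIT//.
- by apply/measurable_EFinP; exact: measurable_indic.
Qed.

End tonelli_bound.

Lemma integral_affine d (T : measurableType d) (R : realType)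
    (Q : probability T R) (f : T -> \bar R) (a b : R) :
  measurable_fun setT f -> (forall x, (0 <= f x)%E) -> 0 <= a -> 0 <= b ->
  (\int[Q]_x (a%:E * f x + b%:E) = a%:E * \int[Q]_x f x + b%:E)%E.
Proof.
move=> mf f0 a0 b0; rewrite ge0_integralD//; last 2 first.
- by move=> x _; rewrite mule_ge0// lee_fin.
- exact: emeasurable_funM.
by rewrite ge0_integralZl// integral_cst//= probability_setT mule1.
Qed.

(** With [L] the complexity term and [1 <= 3 * L]: the translation cost gives
    [10 + 12 * ln (1 + C1 * Cx)], an additive constant 3 gives 9, and the exponent
    [2 * (C ^+ 2 * expR C)] is tripled. *)
Definition oracle_constant (R : realType) (C C1 Cx : R) : R :=
  19 + 12 * ln (1 + C1 * Cx) + 6 * (C ^+ 2 * expR C).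

Lemma oracle_constant_gt0 (R : realType) (C C1 Cx : R) :
  0 < C1 -> 0 < Cx -> 0 < oracle_constant C C1 Cx.
Proof.
move=> C10 Cx0; rewrite /oracle_constant.
have : 0 <= ln (1 + C1 * Cx) by rewrite ln_ge0// lerDl mulr_ge0// ltW.
have : 0 <= C ^+ 2 * expR C by rewrite mulr_ge0 ?sqr_ge0 ?expR_ge0.
lra.
Qed.

(** * Excess risk of the quantile Gibbs posterior *)

Section excess_risk.
Context {R : realType}.
Variables (C C1 Cx : R).
Hypotheses (C_gt0 : 0 < C) (C1_gt0 : 0 < C1) (Cx_gt0 : 0 < Cx).
Variables (tau : R) (n d : nat) (P : probability (R * d.-tuple R)%type R).
Variables (disp : measure_display) (Omega : measurableType disp).
Variables (Pr : probability Omega R) (Z : 'I_n -> {RV Pr >-> (R * d.-tuple R)%type}).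
Variable a : d.-tuple R.
Hypotheses (tau01 : 0 < tau < 1) (n_gt0 : (0 < n)%N) (d_gt0 : (0 < d)%N).
Hypothesis iidZ : iid_from Pr P Z.
Hypothesis norm2_le : (\int[P]_z (norm2 z.2)%:E <= Cx%:E)%E.
Hypothesis loss_le : forall theta : d.-tuple R, l1_ball C1 theta ->
  {ae P, forall z, 0 <= quantile_loss tau z.1 (dotv z.2 theta) <= C}.
Local Notation lam := (Num.sqrt n%:R : R).
Local Notation s := ((Cx * n%:R * Num.sqrt d%:R)^-1 : R).
Hypothesis a_le : norm1 a <= C1 - 2 * d%:R * s.
Local Notation loss theta := (fun z : R * d.-tuple R => quantile_loss tau z.1 (dotv z.2 theta)).
Local Notation risk := (quantile_risk P tau).
Local Notation emp w := (empirical_risk tau (fun i => Z i w)).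
Local Notation pi := (prior d s C1).
Local Notation B := (l1_ball C1).
Local Notation S := (small_ball s a).
Let rho w := gibbs_posterior lam tau pi (fun i => Z i w).
(** It agrees with [risk] on the l1 ball, where the loss is bounded; where the risk is infinite,
    [fine] returns 0. *)
Let riskR (theta : d.-tuple R) : R := fine (risk theta).

Let n0 : (0 : R) < n%:R. Proof. by rewrite ltr0n. Qed.
Let sd0 : (0 : R) < Num.sqrt d%:R. Proof. by rewrite sqrtr_gt0 ltr0n. Qed.
Let lam_gt0 : 0 < lam. Proof. by rewrite sqrtr_gt0. Qed.
Let s_gt0 : 0 < s. Proof. by rewrite invr_gt0 !mulr_gt0. Qed.

Let loss_ge0 (theta : d.-tuple R) z : 0 <= loss theta z.
Proof. exact: quantile_loss_ge0. Qed.

Let mloss (theta : d.-tuple R) : measurable_fun setT (loss theta).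
Proof.
exact: (measurableT_comp (@measurable_quantile_loss_dotv R tau tau01 d) (pair2_measurable theta)).
Qed.

Let risk_ge0 theta : (0 <= risk theta)%E.
Proof. by apply: integral_ge0 => z _; rewrite lee_fin. Qed.

Let mrisk : measurable_fun setT risk.
Proof.
apply: (measurable_fun_fubini_tonelli_G (m1 := P)
  (fun p : (R * d.-tuple R) * d.-tuple R => (loss p.2 p.1)%:E)).
- by apply/measurable_EFinP; exact: measurable_quantile_loss_dotv.
- by move=> p; rewrite lee_fin.
Qed.

Let mriskR : measurable_fun setT riskR.
Proof. exact: (measurableT_comp (fine_measurable measurableT) mrisk). Qed.

Let riskR_ge0 theta : 0 <= riskR theta.
Proof. by rewrite fine_ge0. Qed.

Let cstP (Q : probability (R * d.-tuple R)%type R) (c : R) : (\int[Q]_x c%:E = c%:E)%E.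
Proof. by rewrite integral_cst//= probability_setT mule1. Qed.

Let risk_le theta : B theta -> (risk theta <= C%:E)%E.
Proof.
move=> tB; rewrite -(cstP P C).
apply: ae_ge0_le_integral => //.
- by move=> z _; rewrite lee_fin.
- exact/measurable_EFinP.
- by move=> z _; rewrite lee_fin ltW.
- by apply: filterS (loss_le tB) => z /andP[_ zC] _; rewrite lee_fin.
Qed.

Let riskE theta : B theta -> risk theta = (riskR theta)%:E.
Proof.
move=> tB; rewrite /riskR fineK// ge0_fin_numE//.
by rewrite (le_lt_trans (risk_le tB))// ltry.
Qed.

Let riskR_le theta : B theta -> 0 <= riskR theta <= C.
Proof. by move=> tB; rewrite riskR_ge0/= -lee_fin -riskE// risk_le. Qed.

Let aB : B a.
Proof.
by rewrite /l1_ball/= (le_trans a_le)// gerBl mulr_ge0// ltW.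
Qed.

Let Rbar : R := riskR a + 2 / n%:R.

Let mnorm2 : measurable_fun setT (fun z : R * d.-tuple R => norm2 z.2).
Proof.
apply: (measurableT_comp (continuous_measurable_fun (@sqrt_continuous R))).
apply: measurable_sum => i; apply: measurable_funX.
exact: (measurableT_comp (@measurable_tnth _ R d i) measurable_snd).
Qed.

(** The loss is 1-Lipschitz in the prediction, so moving the parameter by at most the radius [A]
    costs at most [A * Cx], which the choice of [s] makes equal to [2 / n%:R]. *)
Let riskR_small_ball theta : S theta -> riskR theta <= Rbar.
Proof.
move=> tS; have tB := small_ball_sub s_gt0 a_le tS.
pose A := 2 * s * Num.sqrt d%:R.
have A0 : 0 < A by rewrite !mulr_gt0.
have ACx : A * Cx = 2 / n%:R.
  by rewrite /A; field; rewrite !gt_eqF.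
have tA : sqdist a theta <= A ^+ 2.
  apply: (le_trans tS); rewrite /A !exprMn sqr_sqrtr ?ler0n//.
  by rewrite le_eqVlt; apply/orP; left; apply/eqP; ring.
rewrite -lee_fin -riskE// /Rbar EFinD -riskE// -ACx.
apply: (@le_trans _ _ (\int[P]_z ((loss a z)%:E + A%:E * (norm2 z.2)%:E)))%E.
  apply: ge0_le_integral => //.
  - by move=> z _; rewrite lee_fin.
  - exact/measurable_EFinP.
  - by apply: emeasurable_funD; [|apply: emeasurable_funM => //]; exact/measurable_EFinP.
  - move=> z _; rewrite -EFinM -EFinD lee_fin.
    apply: (le_trans (quantile_loss_lipschitz tau01 _ _ (dotv z.2 a))).
    by rewrite lerD2l mulrC; exact: dotv_le.
rewrite ge0_integralD//; first last.
- by apply: emeasurable_funM => //; exact/measurable_EFinP.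
- by move=> z _; rewrite -EFinM lee_fin mulr_ge0 ?sqrtr_ge0// ltW.
- exact/measurable_EFinP.
- by move=> z _; rewrite lee_fin.
rewrite leeD2l// ge0_integralZl//; first last.
- by rewrite lee_fin ltW.
- by move=> z _; rewrite lee_fin sqrtr_ge0.
- exact/measurable_EFinP.
by rewrite [leRHS](EFinM A Cx); apply: lee_wpmul2l => //; rewrite lee_fin ltW.
Qed.

Let c : R := C ^+ 2 * expR C.

Let c_ge0 : 0 <= c. Proof. by rewrite mulr_ge0 ?sqr_ge0 ?expR_ge0. Qed.

Let lam2 : lam ^+ 2 = n%:R. Proof. by rewrite sqr_sqrtr// ler0n. Qed.

Let memp : measurable_fun setT (fun p : Omega * d.-tuple R => emp p.1 p.2).
Proof.
apply: measurable_funM => //; apply: measurable_sum => i.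
have mz : measurable_fun setT (fun p : Omega * d.-tuple R => (Z i p.1, p.2)).
  apply: measurable_fun_pair; last exact: measurable_snd.
  by apply: measurableT_comp => //; exact: measurable_fst.
exact: (measurableT_comp (@measurable_quantile_loss_dotv R tau tau01 d) mz).
Qed.

Let deviation_le theta (sg : R) : sg ^+ 2 = 1 -> B theta ->
  (\int[Pr]_w (expR (lam * (sg * (emp w theta - riskR theta))))%:E <= (expR c)%:E)%E.
Proof.
move=> sg2 tB.
have lossC : {ae P, forall z, loss theta z <= C}.
  by apply: filterS (loss_le tB) => z /andP[].
(* Equality holds since [lam ^+ 2 = n%:R]: this choice of [lam] makes the moment bound independent
   of [n]. *)
have sn : (sg * lam / n%:R) ^+ 2 * n%:R <= 1.
  rewrite !exprMn exprVn lam2 sg2 le_eqVlt; apply/orP; left; apply/eqP.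
  by field; rewrite gt_eqF.
apply: le_trans (iid_integral_expR_le iidZ (mloss theta) (loss_ge0 theta) lossC
  (riskE tB) (riskR_le tB) n_gt0 sn).
rewrite le_eqVlt; apply/orP; left; apply/eqP; apply: eq_integral => w _.
congr (expR _)%:E; rewrite /empirical_risk sumrB sumr_const card_ord -[_ *+ n]mulr_natl.
by field; rewrite gt_eqF.
Qed.

Let sigma : R := fine (pi S).

Let piS : pi S = sigma%:E.
Proof. by rewrite /sigma fineK// fin_num_measure//; exact: measurable_small_ball. Qed.

Let sigma_ge : 3 / 4 * shift_ratio s a <= sigma.
Proof. by rewrite -lee_fin -piS; exact: prior_small_ball. Qed.

Let sigma_gt0 : 0 < sigma.
Proof. by apply: lt_le_trans sigma_ge; rewrite mulr_gt0// shift_ratio_gt0. Qed.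

Let dev w : \bar R := (upper_dev pi lam (emp w) B riskR +
  lower_dev pi lam (emp w) S Rbar sigma)%E.

Let Fup (p : Omega * d.-tuple R) : R := expR (lam * (riskR p.2 - emp p.1 p.2)).
Let Flo (p : Omega * d.-tuple R) : R := expR (lam * (emp p.1 p.2 - Rbar)).

Let mFup : measurable_fun setT Fup.
Proof.
apply: measurableT_comp => //; apply: measurable_funM => //; apply: measurable_funB => //.
exact: (measurableT_comp mriskR measurable_snd).
Qed.

Let mFlo : measurable_fun setT Flo.
Proof.
apply: measurableT_comp => //; apply: measurable_funM => //; exact: measurable_funB.
Qed.

Let mup : measurable_fun setT (fun w => upper_dev pi lam (emp w) B riskR).
Proof.
apply: (measurable_partial_integral pi mFup) => //; last exact: measurable_l1_ball.
by move=> p; exact: expR_ge0.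
Qed.

Let mlo : measurable_fun setT (fun w => lower_dev pi lam (emp w) S Rbar sigma).
Proof.
apply: emeasurable_funM; first exact: measurable_cst.
apply: (measurable_partial_integral pi mFlo) => //; last exact: measurable_small_ball.
by move=> p; exact: expR_ge0.
Qed.

Let up_ge0 w : (0 <= upper_dev pi lam (emp w) B riskR)%E.
Proof. by apply: integral_ge0 => t _; rewrite lee_fin expR_ge0. Qed.

Let lo_ge0 w : (0 <= lower_dev pi lam (emp w) S Rbar sigma)%E.
Proof.
rewrite mule_ge0 ?lee_fin ?invr_ge0 ?(ltW sigma_gt0)//.
by apply: integral_ge0 => t _; rewrite lee_fin expR_ge0.
Qed.

Let mdev : measurable_fun setT dev.
Proof. exact: emeasurable_funD. Qed.

Let dev_ge0 w : (0 <= dev w)%E. Proof. exact: adde_ge0. Qed.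

(** Each deviation contributes [expR c] after Tonelli's theorem. For the lower one, [riskR] is at
    most [Rbar] on [S], so [Rbar] may be replaced by the true risk, and [sigma^-1] cancels the mass
    of [S]. *)
Let integral_dev_le : (\int[Pr]_w dev w <= (2 * expR c)%:E)%E.
Proof.
have ec0 := expR_ge0 c.
rewrite /dev ge0_integralD//.
have -> : (2 * expR c)%:E = ((expR c)%:E + (expR c)%:E)%E.
  by rewrite -EFinD; congr _%:E; ring.
apply: leeD.
  apply: (@le_trans _ _ ((expR c)%:E * pi B)%E).
    apply: (@integral_partial_le _ _ _ _ _ Pr pi Fup B mFup (fun p => expR_ge0 _)
      (@measurable_l1_ball R d C1) _ ec0) => t tB; rewrite /Fup/=.
    have N1 : (-1 : R) ^+ 2 = 1 by rewrite sqrrN expr1n.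
    apply: le_trans (deviation_le N1 tB); rewrite le_eqVlt; apply/orP; left; apply/eqP.
    by apply: eq_integral => w _; rewrite mulN1r opprB.
  rewrite -[leRHS]mule1; apply: lee_wpmul2l; first by rewrite lee_fin.
  by apply: probability_le1; exact: measurable_l1_ball.
rewrite /lower_dev ge0_integralZl; first last.
- by rewrite lee_fin invr_ge0 ltW.
- by move=> w _; apply: integral_ge0 => t _; rewrite lee_fin expR_ge0.
- apply: (measurable_partial_integral pi mFlo); last exact: measurable_small_ball.
  by move=> p; exact: expR_ge0.
- exact: measurableT.
apply: (@le_trans _ _ ((sigma^-1)%:E * ((expR c)%:E * pi S)))%E.
  apply: lee_wpmul2l; first by rewrite lee_fin invr_ge0 ltW.
  apply: (@integral_partial_le _ _ _ _ _ Pr pi Flo S mFlo (fun p => expR_ge0 _)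
    (@measurable_small_ball R d s a) _ ec0) => t tS; have tB := small_ball_sub s_gt0 a_le tS.
  apply: le_trans (@deviation_le t 1 (expr1n _ 2) tB).
  have me : measurable_fun setT (fun w => emp w t).
    exact: (measurableT_comp memp (pair2_measurable t)).
  apply: ge0_le_integral => //.
  - by move=> w _; rewrite lee_fin expR_ge0.
  - by apply/measurable_EFinP; exact: (measurableT_comp mFlo (pair2_measurable t)).
  - apply/measurable_EFinP; apply: measurableT_comp => //.
    by do 2 (apply: measurable_funM => //); exact: measurable_funB.
  move=> w _; rewrite lee_fin ler_expR mul1r ler_wpM2l ?lerB//; last exact: riskR_small_ball.
rewrite piS -!EFinM lee_fin le_eqVlt; apply/orP; left; apply/eqP.
by field; rewrite gt_eqF.
Qed.

Let gibbs_oracle_dev w (p : R) : 1 <= p ->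
  (lam%:E * \int[rho w]_t risk t <= (p^-1)%:E * dev w +
    (2 * ln p - 2 + lam * Rbar - ln sigma)%:E)%E.
Proof.
move=> p1; apply: (gibbs_oracle (r := emp w)) => //.
- by move=> t; rewrite mulr_ge0 ?invr_ge0// sumr_ge0.
- exact: measurable_empirical_risk.
- exact: measurable_l1_ball.
- exact: measurable_small_ball.
- by have := prior_l1_ballC d_gt0 s_gt0 a_le.
Qed.

(** The posterior integral is a quotient of two integrals against the fixed prior, each measurable
    in the sample by Tonelli's theorem. The inverse of the normalizer is written as a power to use
    [measurable_powR]. *)
Let mintegral_rho : measurable_fun setT (fun w => \int[rho w]_t risk t)%E.
Proof.
pose W (p : Omega * d.-tuple R) : R := expR (- (lam * emp p.1 p.2)).
have mW : measurable_fun setT W.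
  apply: measurableT_comp => //; apply: measurableT_comp => //.
  exact: measurable_funM.
pose zf w := (\int[pi]_t (W (w, t))%:E)%E.
have mz : measurable_fun setT zf.
  apply: (measurable_fun_fubini_tonelli_F (m2 := pi) (EFin \o W)).
  - exact/measurable_EFinP.
  - by move=> p; rewrite lee_fin expR_ge0.
have emp_ge0 w t : 0 <= emp w t by rewrite mulr_ge0 ?invr_ge0// sumr_ge0.
have rhoE w : (\int[rho w]_t risk t =
    ((fine (zf w)) `^ (-1))%:E * \int[pi]_t (risk t * (W (w, t))%:E))%E.
  have [z /andP[z0 _] zE] := gibbs_mass pi lam_gt0 (emp_ge0 w) (fun t => erefl)
    (fun t => gibbs_weight_ge0 lam tau (fun i => Z i w) t)
    (measurable_gibbs_weight lam tau (fun i => Z i w)).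
  have -> : fine (zf w) = z by rewrite /zf [X in fine X]zE.
  by rewrite powR_inv1 ?(ltW z0)//; apply: (integral_gibbs lam_gt0 (emp_ge0 w) _ _ _ _ _ zE).
under eq_fun do rewrite rhoE.
apply: emeasurable_funM.
  apply/measurable_EFinP; apply: (measurableT_comp (measurable_powR _)).
  exact: (measurableT_comp (fine_measurable measurableT) mz).
apply: (measurable_fun_fubini_tonelli_F (m2 := pi)
  (fun p : Omega * d.-tuple R => risk p.2 * (W p)%:E)%E).
- apply: emeasurable_funM; last exact/measurable_EFinP.
  exact: (measurableT_comp mrisk measurable_snd).
- by move=> p; rewrite mule_ge0// lee_fin expR_ge0.
Qed.

Let X w : \bar R := (\int[rho w]_t risk t)%E.

Let X_ge0 w : (0 <= X w)%E. Proof. exact: integral_ge0. Qed.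

Let sigma_le1 : sigma <= 1.
Proof.
by rewrite -lee_fin -piS; apply: probability_le1; exact: measurable_small_ball.
Qed.

Let lamRbar : lam * Rbar <= lam * riskR a + 2.
Proof.
rewrite /Rbar mulrDr lerD2l.
have -> : (2 : R) / n%:R = 2 / lam ^+ 2 by rewrite lam2.
have l1 : 1 <= lam by rewrite -[leLHS]sqrtr1 ler_wsqrtr// ler1n.
have -> : lam * (2 / lam ^+ 2) = 2 / lam by field; rewrite gt_eqF.
by rewrite ler_pdivrMr//; lra.
Qed.

Hypotheses (norm0_ge1 : (1 <= norm0 a)%N) (norm0_lt : (norm0 a < n)%N) (n_lt_d : (n < d)%N).

Let xi : R := (norm0 a)%:R * ln (n%:R * Num.sqrt d%:R / (norm0 a)%:R) / lam.

(** The mass bound costs the translation term plus [- ln (3 / 4) <= 1]; the remaining constants are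
    absorbed since the complexity term [lam * xi] is at least [1 / 3]. *)
Let oracle_cost : 2 * c + 2 - ln sigma <= (oracle_constant C C1 Cx) * (lam * xi).
Proof.
have a1 : 0 <= norm1 a <= C1 by rewrite sumr_ge0//=.
have [h1 h2] := complexity_le C1_gt0 Cx_gt0 norm0_ge1 norm0_lt n_lt_d a1.
have h3 := shift_ratio_cost s_gt0 norm0_ge1.
have r0 := shift_ratio_gt0 s a.
have h4 : - ln sigma <= 1 - ln (shift_ratio s a).
  have : ln (3 / 4 * shift_ratio s a) <= ln sigma.
    by rewrite ler_ln ?posrE// mulr_gt0.
  have q0 : (0 : R) < 3 / 4 by lra.
  rewrite lnM ?posrE//; have := ln_le_tangent q0 ltr01; rewrite ln1.
  have -> : (1 : R) / (3 / 4) = 4 / 3 by field.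
  lra.
rewrite /xi [lam * _]mulrC divfK ?gt_eqF//.
rewrite /oracle_constant -/c.
set L := (norm0 a)%:R * ln (n%:R * Num.sqrt d%:R / (norm0 a)%:R) in h1 h2 *.
have h5 : 2 * c <= 2 * c * (3 * L) by rewrite ler_peMr// mulr_ge0.
have -> : (19 + 12 * ln (1 + C1 * Cx) + 6 * c) * L =
  (10 + 12 * ln (1 + C1 * Cx)) * L + 3 * (3 * L) + 2 * c * (3 * L) by ring.
lra.
Qed.

Let riskaE : risk a = (riskR a)%:E. Proof. exact: riskE. Qed.

Lemma expected_excess_risk :
  (\int[Pr]_w \int[rho w]_t risk t - risk a <= ((oracle_constant C C1 Cx) * xi)%:E)%E.
Proof.
have ec := expR_gt0 c.
have ec1 : 1 <= expR c by rewrite -expR0 ler_expR.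
have lns : 0 <= - ln sigma by rewrite oppr_ge0 ln_le0.
have lR : 0 <= lam * Rbar.
  by rewrite mulr_ge0 ?(ltW lam_gt0)// addr_ge0// divr_ge0.
set r := 2 * c + lam * Rbar - ln sigma.
have r0 : 0 <= r by rewrite /r; have := c_ge0; lra.
have mX : measurable_fun setT X by exact: mintegral_rho.
(* The oracle inequality at [p = expR c], with its [- 2] moved to the left so that both sides are
   affine with nonnegative coefficients. *)
have le_w w : (lam%:E * X w + 2%:E <= (expR c)^-1%:E * dev w + r%:E)%E.
  have := gibbs_oracle_dev w ec1; rewrite -/(X w) expRK => /(leeD2r 2%:E) /le_trans; apply.
  by rewrite -addeA -EFinD leeD2l// lee_fin /r; lra.
have : (lam%:E * \int[Pr]_w X w + 2%:E <= (expR c)^-1%:E * (2 * expR c)%:E + r%:E)%E.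
  apply: (@le_trans _ _ ((expR c)^-1%:E * \int[Pr]_w dev w + r%:E)%E); last first.
    by rewrite leeD2r// lee_wpmul2l// lee_fin invr_ge0 ltW.
  rewrite -(integral_affine Pr mX X_ge0 (ltW lam_gt0) (ler0n _ 2)).
  rewrite -(integral_affine Pr mdev dev_ge0 _ r0) ?invr_ge0 ?(ltW ec)//.
  apply: ge0_le_integral => //.
  - by move=> w _; rewrite adde_ge0 ?mule_ge0// lee_fin ltW.
  - by apply: emeasurable_funD => //; exact: emeasurable_funM.
  - by apply: emeasurable_funD => //; exact: emeasurable_funM.
have -> : (\int[Pr]_w \int[rho w]_t risk t = \int[Pr]_w X w)%E by [].
have : (0 <= \int[Pr]_w X w)%E by exact: integral_ge0.
rewrite riskaE; case: (\int[Pr]_w X w)%E => [x||]//=; last first.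
  by move=> _; rewrite gt0_muley ?lte_fin// addye// -EFinM -EFinD leye_eq.
move=> _; rewrite -!EFinM -!EFinD !lee_fin.
have -> : (expR c)^-1 * (2 * expR c) = 2 by field; rewrite gt_eqF.
move=> h; rewrite -(ler_pM2l lam_gt0) mulrBr [lam * (_ * xi)]mulrCA.
apply: le_trans oracle_cost; move: h lamRbar; rewrite /r; lra.
Qed.

Lemma excess_risk_tail (eps : R) : 0 < eps < 1 ->
  ((1 - eps)%:E <= Pr [set w | \int[rho w]_t risk t - risk a <=
    ((oracle_constant C C1 Cx) * (xi + lam^-1 * ln (2 / eps)))%:E])%E.
Proof.
move=> /andP[e0 e1].
have ec := expR_gt0 c.
pose p := expR c / eps.
have p0 : 0 < p by rewrite divr_gt0.
have p1 : 1 <= p.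
  rewrite ler_pdivlMr// mul1r (le_trans (ltW e1))// -expR0 ler_expR//.
have mX : measurable_fun setT X by exact: mintegral_rho.
(* At level [2 * p], Markov's inequality gives probability at most [eps], because the mean of [dev]
   is at most [2 * expR c = 2 * p * eps]. Off [E], the term [p^-1 * dev w] is at most 2 and cancels
   the [- 2] of the oracle inequality. *)
pose E : set Omega := [set w | ((2 * p)%:E < dev w)%E].
have mE : measurable E.
  by rewrite -[E]setTI; exact: emeasurable_fun_o_infty.
set T := [set w | _].
have mT : measurable T.
  rewrite -[T]setTI; apply: emeasurable_fun_infty_c => //.
  by apply: emeasurable_funB.
have PE : (Pr E <= eps%:E)%E.
  have : ((2 * p)%:E * Pr E <= (2 * p)%:E * eps%:E)%E.
    rewrite -integral_cst// -EFinM.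
    have -> : 2 * p * eps = 2 * expR c by rewrite /p; field; rewrite gt_eqF.
    apply: le_trans integral_dev_le.
    apply: (@le_trans _ _ (\int[Pr]_(w in E) dev w)%E).
      apply: ge0_le_integral => //.
      - by move=> w _; rewrite lee_fin mulr_ge0// ltW.
      - exact: measurable_funTS.
      - by move=> w /ltW.
    exact: ge0_subset_integral.
  by rewrite lee_pmul2l// lte_fin mulr_gt0.
have ET : ~` E `<=` T.
  move=> w /= /negP; rewrite -leNgt => dw.
  have := gibbs_oracle_dev w p1; rewrite -/(X w) => h.
  have {}h : (lam%:E * X w <= (2 + (2 * ln p - 2 + lam * Rbar - ln sigma))%:E)%E.
    apply: (le_trans h); rewrite [leRHS]EFinD leeD2r//.
    apply: (@le_trans _ _ ((p^-1)%:E * (2 * p)%:E)%E).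
      by apply: lee_wpmul2l => //; rewrite lee_fin invr_ge0 ltW.
    by rewrite -EFinM lee_fin le_eqVlt; apply/orP; left; apply/eqP; field; rewrite gt_eqF.
  rewrite /T/= riskaE -/(X w).
  move: h (X_ge0 w); case: (X w) => [x||]//=; last by rewrite gt0_muley ?lte_fin.
  rewrite -EFinM -EFinD !lee_fin => h _.
  rewrite -(ler_pM2l lam_gt0) mulrBr mulrCA [lam * (xi + _)]mulrDr mulVKf ?gt_eqF// mulrDr.
  have lnp : ln p = c - ln eps by rewrite /p lnM ?posrE ?invr_gt0// lnV ?posrE// expRK.
  have ln2e : ln (2 / eps) = ln 2 - ln eps by rewrite lnM ?posrE ?invr_gt0// lnV ?posrE.
  have ln20 : 0 <= ln 2 :> R by rewrite ln_ge0// ler1n.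
  have lne : 0 <= ln (2 / eps) by rewrite ln_ge0// ler_pdivlMr//; lra.
  (* This absorbs the part [- 2 * ln eps] of [2 * ln p]. *)
  have K2 : 2 * ln (2 / eps) <= (oracle_constant C C1 Cx) * ln (2 / eps).
    rewrite ler_wpM2r// /oracle_constant -/c.
    have : 0 <= ln (1 + C1 * Cx) by rewrite ln_ge0// lerDl mulr_ge0// ltW.
    by have := c_ge0; lra.
  move: h K2 oracle_cost lamRbar; rewrite lnp ln2e; lra.
apply: (@le_trans _ _ (Pr (~` E))); last first.
  by apply: le_measure; rewrite ?inE//; exact: measurableC.
rewrite probability_setC//.
have : (0 <= Pr E)%E by exact: measure_ge0.
by case: (Pr E) PE => [x||]//; rewrite -EFinB !lee_fin; lra.
Qed.

End excess_risk.

Theorem theorem1 (R : realType) (C C1 Cx : R)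
    (C_gt0 : 0 < C) (C1_gt0 : 0 < C1) (Cx_gt0 : 0 < Cx) :
  exists K K' : R, [/\ 0 < K, 0 < K' &
    forall (tau : R) (n d : nat) (P : probability (R * d.-tuple R)%type R)
      (disp : measure_display) (Omega : measurableType disp)
      (Pr : probability Omega R)
      (Z : 'I_n -> {RV Pr >-> (R * d.-tuple R)%type})
      (theta_star : d.-tuple R),
    let lambda := Num.sqrt n%:R : R in
    let varsigma := (Cx * n%:R * Num.sqrt d%:R)^-1 : R in
    let rho w := gibbs_posterior lambda tau (prior d varsigma C1)
                   (fun i => Z i w) in
    let s_star := norm0 theta_star in
    let R_star := quantile_risk P tau theta_star in
    let xi := s_star%:R * ln (n%:R * Num.sqrt d%:R / s_star%:R)
              / Num.sqrt n%:R : R in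
    0 < tau < 1 ->
    (0 < n)%N ->
    (0 < d)%N ->
    iid_from Pr P Z ->
    (\int[P]_z (norm2 z.2)%:E <= Cx%:E)%E ->
    (forall theta, l1_ball C1 theta ->
       {ae P, forall z,
          0 <= quantile_loss tau z.1 (dotv z.2 theta) <= C}) ->
    (forall theta, (R_star <= quantile_risk P tau theta)%E) ->
    (1 <= s_star < n)%N ->
    (n < d)%N ->
    norm1 theta_star <= C1 - 2 * d%:R * varsigma ->
    (\int[Pr]_w (\int[rho w]_theta quantile_risk P tau theta) - R_star
       <= (K * xi)%:E)%E
    /\
    (forall eps : R, 0 < eps < 1 ->
       ((1 - eps)%:E <=
          Pr [set w | \int[rho w]_theta quantile_risk P tau theta - R_star
                <= (K' * (xi + (Num.sqrt n%:R)^-1 * ln (2 / eps)))%:E])%E)].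
Proof.
have K0 := oracle_constant_gt0 C C1_gt0 Cx_gt0.
exists (oracle_constant C C1 Cx), (oracle_constant C C1 Cx); split => //.
move=> tau n d P disp Omega Pr Z a /= tau01 n0 d0 iidZ Xle lossC _.
move=> /andP[a1 an] nd a_le; split.
  exact: (expected_excess_risk C_gt0 C1_gt0 Cx_gt0).
by move=> eps; exact: (excess_risk_tail C_gt0 C1_gt0 Cx_gt0).
Qed.
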